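(* Assume that for every integer $n\ge1$ and every real transcendental $\zeta$ there exist infinitely many $k$ such that the $n+1$ consecutive best approximation polynomials $P_k,P_{k+1},\dots,P_{k+n}$ for $(n,\zeta)$ are linearly independent, i.e. their coefficient vectors span $\mathbb R^{n+1}$. Then for every $\epsilon>0$ there exists $n_0=n_0(\epsilon)$ such that for every real transcendental $\zeta$ and every $n\ge n_0$, $$\widehat w_n(\zeta)\le 2n-1-\log 2+\epsilon .$$
   Context: For $P\in\mathbb Z[X]$, $H(P)$ denotes the maximum absolute value of its coefficients. A best approximation for $(n,\zeta)$ is a nonzero $P\in\mathbb Z[X]$ of degree at most $n$ such that every nonzero $Q\in\mathbb Z[X]$ of degree at most $n$ with $H(Q)<H(P)$ satisfies $|Q(\zeta)|>|P(\zeta)|$. For transcendental $\zeta$ these form, up to sign, a sequence $P_1,P_2,\dots$ with $H(P_1)\le H(P_2)\le\cdots$ and $|P_1(\zeta)|>|P_2(\zeta)|>\cdots$. $\widehat w_n(\zeta)$ is the supremum of $\nu$ such that, for all sufficiently large $X$, there is a nonzero $P\in\mathbb Z[X]$ with $\deg P\le n$, $H(P)\le X$ and $|P(\zeta)|\le X^{-\nu}$. *)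

(* Defs.v *)
From Stdlib Require Import Reals ZArith.
Open Scope R_scope.

(* An integer polynomial is represented by its coefficient function:
   P i is the coefficient of X^i. *)
Definition zpoly := nat -> Z.

Definition deg_le (P : zpoly) (n : nat) : Prop :=
  forall i : nat, (n < i)%nat -> P i = 0%Z.

Definition nonzero_le (n : nat) (P : zpoly) : Prop :=
  exists i : nat, (i <= n)%nat /\ P i <> 0%Z.

Definition peval (n : nat) (P : zpoly) (x : R) : R :=
  sum_f_R0 (fun i => IZR (P i) * x ^ i) n.

Fixpoint height (n : nat) (P : zpoly) : Z :=
  match n with
  | O => Z.abs (P O)
  | S m => Z.max (height m P) (Z.abs (P (S m)))
  end.

Definition transcendental (zeta : R) : Prop :=
  forall (d : nat) (P : zpoly), deg_le P d -> nonzero_le d P -> peval d P zeta <> 0.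

Definition best_approx (n : nat) (zeta : R) (P : zpoly) : Prop :=
  deg_le P n /\ nonzero_le n P /\
  forall Q : zpoly, deg_le Q n -> nonzero_le n Q ->
    (height n Q < height n P)%Z ->
    Rabs (peval n Q zeta) > Rabs (peval n P zeta).

Definition best_approx_seq (n : nat) (zeta : R) (Pseq : nat -> zpoly) : Prop :=
  (forall k, best_approx n zeta (Pseq k)) /\
  (forall k, Rabs (peval n (Pseq (S k)) zeta) < Rabs (peval n (Pseq k) zeta)) /\
  (forall P, best_approx n zeta P ->
     exists k, (forall i, P i = Pseq k i) \/ (forall i, P i = (- Pseq k i)%Z)).

Definition lin_indep (n : nat) (F : nat -> zpoly) : Prop :=
  forall c : nat -> R,
    (forall i, (i <= n)%nat -> sum_f_R0 (fun j => c j * IZR (F j i)) n = 0) ->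
    forall j, (j <= n)%nat -> c j = 0.

(* nu belongs to the set whose supremum is \hat w_n(zeta): for all
   sufficiently large X there is a nonzero P, deg P <= n, H(P) <= X,
   |P(zeta)| <= X^{-nu}. *)
Definition what_admissible (n : nat) (zeta nu : R) : Prop :=
  exists X0 : R, forall X : R, X0 <= X ->
    exists P : zpoly, deg_le P n /\ nonzero_le n P /\
      IZR (height n P) <= X /\ Rabs (peval n P zeta) <= Rpower X (- nu).

(* Main.v *)
(* Write [H_k], [L_k] for the height and the absolute value at [zeta] of the k-th best
   approximation [P_k], and suppose that an exponent [nu > 2n - 1 - ln 2 + eps] is
   admissible, so that [L_k] is essentially at most [H_{k+1}^(-nu)].

   Since [nu > 2n - 2], every integer polynomial [R] of degree [d < n] satisfies
   [|R(zeta)| >> H(R)^-(d+n-1)]: otherwise an irreducible [R] would have too small a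
   resultant with the admissible polynomial of height slightly below [H(R)].  If [P_k]
   and [P_{k+1}] had a common factor [G], this bound for [G] and the resultant of the
   cofactors would give [nu <= 2n - 2].  So consecutive best approximations are
   eventually coprime, and their resultant yields
   [(nu - n) ln H_{k+1} <= (n - 1) ln H_k + O(1)].

   When [P_k, ..., P_{k+n}] are linearly independent, their determinant yields
   [nu ln H_{k+1} <= n ln H_{k+n} + O(1)].  Iterating the first inequality [n - 1] times
   bounds [ln H_{k+n} / ln H_{k+1}] by about [((n-1)/(nu-n))^(n-1)], which is close to
   [2 exp(-eps)], whereas [nu / n] is close to [2]. *)
Require Import Defs.
From Stdlib Require Import Reals ZArith Lra Lia.
From mathcomp Require all_boot all_order all_fingroup all_algebra.
From mathcomp Require zify ring lra ssrZ Rstruct.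
Open Scope R_scope.

(** * Heights, and two conditions on a real point *)

Lemma coef_le_height (n : nat) (P : zpoly) (i : nat) :
  (i <= n)%nat -> (Z.abs (P i) <= height n P)%Z.
Proof.
induction n as [|n IH]; intros Hi; simpl; [replace i with 0%nat by lia; lia|].
destruct (Nat.eq_dec i (S n)) as [->|Hne]; [lia|]; specialize (IH ltac:(lia)); lia.
Qed.

Lemma height_nonneg (n : nat) (P : zpoly) : (0 <= height n P)%Z.
Proof. pose proof (coef_le_height n P n (le_n n)); lia. Qed.

(** The form in which transcendence enters the resultant arguments: polynomials of bounded degree
    and height take finitely many values at [z], none of them zero. *)
Definition values_bounded_below (z : R) : Prop := forall (n : nat) (T : Z),
  exists c : R, 0 < c /\ forall P : zpoly, deg_le P n -> nonzero_le n P ->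
    (height n P <= T)%Z -> c <= Rabs (peval n P z).

(** An exponent above [2n - 2] leaves a power of [X] to spare, so the factor [C] can be arbitrary;
    it will absorb the constants of Gelfond's inequality and of the resultants. *)
Definition has_small_values (n : nat) (z : R) : Prop := forall C : R, exists T : nat,
  forall X : nat, (T <= X)%nat -> exists P : zpoly, nonzero_le n P /\
    IZR (height n P) <= INR X /\
    C * INR X ^ (2 * (n - 1)) * Rabs (peval n P z) <= 1.

Module IntegerPolynomials.
Import all_boot all_order all_fingroup all_algebra.
Import zify ring lra ssrZ Rstruct.
Set Implicit Arguments. Unset Strict Implicit. Unset Printing Implicit Defensive.
Import Order.TTheory GRing.Theory Num.Theory.
Local Open Scope ring_scope.
Delimit Scope R_scope with coqR.

(** * Heights and Gelfond's inequality *)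

Lemma norm_cofactor_le (F : realDomainType) n (A : 'M[F]_n) (b : 'I_n -> F) i j :
  (forall k l, `|A k l| <= b k) ->
  `|cofactor A i j| <= n`!%:R * \prod_(k | k != i) b k.
Proof.
move=> Ab; have b_ge0 k : 0 <= b k by apply: le_trans (normr_ge0 _) (Ab k j).
rewrite expand_cofactor; apply: le_trans (ler_norm_sum _ _ _) _.
apply: (@le_trans _ _ (\sum_(s : 'S_n | s i == j) \prod_(k | k != i) b k)).
  apply: ler_sum => s _; rewrite normrM normrX normrN1 expr1n mul1r normr_prod.
  rewrite (eq_bigl (fun k => k != i)); last by move=> k; rewrite eq_sym.
  by apply: ler_prod => k _; rewrite normr_ge0 Ab.
apply: (@le_trans _ _ (\sum_(s : 'S_n) \prod_(k | k != i) b k)).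
  rewrite [leRHS](bigID (fun s : 'S_n => s i == j)) /= lerDl sumr_ge0 // => s _.
  by rewrite prodr_ge0.
by rewrite sumr_const card_Sn mulr_natl.
Qed.

(** By the adjugate identity, [\det A * v j 0] combines the entries of [A *m v] with cofactors as
    coefficients. This serves twice: for interpolation at integers and, with [v] the powers of [z],
    for lower bounds at [z]. *)
Lemma norm_det_le (F : realDomainType) n (A : 'M[F]_n) (b : 'I_n -> F)
    (v : 'cV[F]_n) j :
  (forall k l, `|A k l| <= b k) ->
  `|\det A| * `|v j 0| <=
    n`!%:R * \sum_i (\prod_(k | k != i) b k) * `|(A *m v) i 0|.
Proof.
move=> Ab; rewrite -normrM.
have -> : \det A * v j 0 = \sum_i cofactor A i j * (A *m v) i 0.
  have := mul_adj_mx A => /(congr1 (fun B => (B *m v) j 0)).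
  rewrite -mulmxA mul_scalar_mx [RHS]mxE => <-.
  by rewrite mxE; apply: eq_bigr => i _; rewrite [\adj A _ _]mxE.
apply: le_trans (ler_norm_sum _ _ _) _; rewrite mulr_sumr.
apply: ler_sum => i _; rewrite normrM mulrA ler_wpM2r //.
exact: norm_cofactor_le.
Qed.

Definition hgt (p : {poly int}) : nat := \max_(i < size p) absz (p`_i)%R.

Lemma coef_le_hgt (p : {poly int}) i : (absz (p`_i)%R <= hgt p)%N.
Proof.
have [lt_ip | le_pi] := ltnP i (size p); last by rewrite nth_default.
exact: (leq_bigmax (Ordinal lt_ip)).
Qed.

Lemma hgt_le (p : {poly int}) b : (forall i, (absz (p`_i)%R <= b)%N) -> (hgt p <= b)%N.
Proof. by move=> pb; apply/bigmax_leqP => i _. Qed.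

Lemma hgt_attained (p : {poly int}) : exists i, hgt p = absz (p`_i)%R.
Proof.
have [-> | nz_p] := eqVneq p 0.
  by exists 0%N; rewrite /hgt size_poly0 big_ord0 coef0.
have sz : (0 < #|'I_(size p)|)%N by rewrite card_ord size_poly_gt0.
have [i] := bigop.eq_bigmax (fun i : 'I_(size p) => absz (p`_i)%R) sz.
by move=> e; exists i.
Qed.

Lemma hgt_gt0 (p : {poly int}) : p != 0 -> (0 < hgt p)%N.
Proof.
move=> nz_p; apply: leq_trans (coef_le_hgt p (size p).-1).
by rewrite absz_gt0 -lead_coefE lead_coef_eq0.
Qed.

Lemma hgtZ a (p : {poly int}) : hgt (a *: p) = (absz a * hgt p)%N.
Proof.
apply/eqP; rewrite eqn_leq; apply/andP; split.
  by apply: hgt_le => i; rewrite coefZ abszM leq_mul2l coef_le_hgt orbT.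
have [i ->] := hgt_attained p; rewrite -abszM -coefZ; exact: coef_le_hgt.
Qed.

Lemma norm_coef_le_hgt (F : realDomainType) (p : {poly int}) i :
  `|(p`_i)%:~R| <= (hgt p)%:R :> F.
Proof. by rewrite -intr_norm -[(hgt p)%:R]/((hgt p)%:~R) ler_int -abszE lez_nat coef_le_hgt. Qed.

Lemma norm_nonzero_intr_ge1 (F : realDomainType) (a : int) : a != 0 -> 1 <= `|a%:~R| :> F.
Proof.
by move=> nz_a; rewrite -intr_norm -[1]/(1%:~R) ler_int -abszE lez_nat absz_gt0.
Qed.

Lemma interpolation_le n (p : {poly int}) (f : 'I_n.+1 -> nat) K :
    (size p <= n.+1)%N -> injective f -> (forall i, f i < K)%N ->
  (hgt p)%:R <= (n.+1`! * (K ^ n) ^ n)%:R * \sum_i `|p.[(f i)%:R]|.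
Proof.
move=> szp injf fK.
have K_gt0 : (0 < K)%N by apply: leq_ltn_trans (fK ord0).
have [j ->] := hgt_attained p.
have [lt_jn | le_nj] := ltnP j n.+1; last first.
  by rewrite nth_default ?(leq_trans szp) // mulr_ge0 // sumr_ge0.
pose A : 'M[int]_n.+1 := (Vandermonde n.+1 (\row_i (f i)%:R))^T.
pose v : 'cV[int]_n.+1 := \col_i p`_i.
have Ab k l : `|A k l| <= (K ^ n)%:R.
  rewrite !mxE normrX normr_nat -natrX ler_nat.
  apply: (@leq_trans (K ^ l)); last by rewrite leq_pexp2l // -ltnS ltn_ord.
  by have [->|l_gt0] := posnP l; rewrite ?expn0 // leq_exp2r // ltnW.
have := norm_det_le v (Ordinal lt_jn) Ab.
have det_ge1 : 1 <= `|\det A|.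
  rewrite det_tr det_Vandermonde -[\prod_(i < _) _]intz norm_nonzero_intr_ge1 //.
  apply/prodf_neq0 => i _; apply/prodf_neq0 => k lt_ik.
  rewrite !mxE subr_eq0 eqr_nat; apply/eqP => /injf e.
  by rewrite e ltnn in lt_ik.
have -> : (absz (p`_j)%R)%:R = `|v (Ordinal lt_jn) 0| by rewrite mxE natz abszE.
move=> Hd; apply: le_trans (_ : `|\det A| * `|v (Ordinal lt_jn) 0| <= _).
  by rewrite ler_peMl.
apply: le_trans Hd _; rewrite natrM -mulrA ler_wpM2l // mulr_sumr.
apply: ler_sum => i _; rewrite prodr_const cardC1 card_ord -natrX ler_wpM2l //.
rewrite (horner_coef_wide _ szp) mxE.
by under eq_bigr => k _ do rewrite !mxE mulrC.
Qed.

(* By interpolation a polynomial of degree at most [n] is small, relative to its height,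
   at no more than [n] of the points [0, ..., 2n]; so two of them are simultaneously large
   at one of these points. *)
Lemma gelfond n : exists2 C : nat, (0 < C)%N & forall p q : {poly int},
  (size p <= n.+1)%N -> (size q <= n.+1)%N ->
  (hgt p * hgt q <= C * hgt (p * q)%R)%N.
Proof.
pose K := (n + n).+1; pose D := (n.+1`! * (K ^ n) ^ n * n.+1)%N.
have D_gt0 : (0 < D)%N by rewrite !muln_gt0 fact_gt0 !expn_gt0.
pose bad (p : {poly int}) := [set x : 'I_K | D%:R * `|p.[x%:R]| < (hgt p)%:R].
have card_bad (p : {poly int}) : (size p <= n.+1)%N -> (#|bad p| <= n)%N.
  move=> szp; rewrite leqNgt; apply/negP => big.
  pose f (i : 'I_n.+1) : nat := enum_val (widen_ord big i).
  have injf : injective f.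
    by move=> i k /val_inj/enum_val_inj/(congr1 val)/= /val_inj.
  have := interpolation_le szp injf (fun i => ltn_ord _).
  apply/negP; rewrite -ltNge.
  have fb i : D%:R * `|p.[(f i)%:R]| < (hgt p)%:R.
    by have := enum_valP (widen_ord big i); rewrite inE.
  (* The factor [n.+1] in [D] pays for summing the strict bound over the [n.+1] bad points. *)
  rewrite -(ltr_pM2l (_ : 0 < n.+1%:R :> int)) // mulrA -natrM mulnC mulr_sumr.
  apply: (@lt_le_trans _ _ (\sum_(i < n.+1) (hgt p)%:R)).
    by apply: ltr_sum => //; apply/hasP; exists ord0; rewrite ?mem_index_enum.
  by rewrite sumr_const card_ord mulr_natl.
(* One factor [D] for each of [p] and [q] at the common good point; [K * K ^ K] bounds the value of
   [p * q] there in terms of its height, as [p * q] has at most [K] coefficients. *)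
exists (D ^ 2 * (K * K ^ K))%N; first by rewrite muln_gt0 expn_gt0 D_gt0 /= muln_gt0 expn_gt0.
move=> p q szp szq.
have [x xp xq] : exists2 x : 'I_K, x \notin bad p & x \notin bad q.
  suff: bad p :|: bad q != setT.
    rewrite -subTset => /subsetPn [x _]; rewrite inE negb_or => /andP[? ?].
    by exists x.
  apply: contraTneq (ltnSn (n + n)) => e; rewrite -leqNgt -[(n + n).+1]card_ord.
  rewrite -cardsT -e cardsU; apply: leq_trans (leq_subr _ _) _.
  exact: leq_add (card_bad _ szp) (card_bad _ szq).
move: xp xq; rewrite !inE -!leNgt => xp xq.
have Hpq : (hgt p)%:R * (hgt q)%:R <= (D ^ 2)%:R * `|(p * q).[x%:R]| :> int.
  rewrite hornerM normrM natrX expr2 mulrACA; exact: ler_pM.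
have szpq : (size (p * q)%R <= K)%N.
  by apply: leq_trans (size_polyMleq _ _) _; rewrite /K; lia.
rewrite -(ler_nat int) natrM; apply: le_trans Hpq _.
rewrite -mulnA [leRHS]natrM ler_wpM2l // (horner_coef_wide _ szpq).
apply: le_trans (ler_norm_sum _ _ _) _.
apply: (@le_trans _ _ (\sum_(i < K) (K ^ K)%:R * (hgt (p * q))%:R)); last first.
  by rewrite sumr_const card_ord -mulnA [leRHS]natrM natrM -[leLHS]mulr_natl.
apply: ler_sum => i _; rewrite normrM mulrC; apply: ler_pM => //.
  rewrite normrX normr_nat -natrX ler_nat.
  apply: (@leq_trans (K ^ i)); last by rewrite leq_pexp2l // ltnW.
  by have [->|l_gt0] := posnP i; rewrite ?expn0 // leq_exp2r // ltnW.
by have := norm_coef_le_hgt int (p * q) i; rewrite intz.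
Qed.

(** * Lower bounds from determinants and resultants *)

Definition ev (F : realFieldType) (z : F) (p : {poly int}) : F :=
  (map_poly intr p).[z].

Section Evaluation.
Variables (F : realFieldType) (z : F).
Local Notation ev := (ev z).
Local Notation h p := ((hgt p)%:R : F).

Lemma evM p q : ev (p * q) = ev p * ev q.
Proof. by rewrite /ev rmorphM hornerM. Qed.

Lemma evZ a p : ev (a *: p) = a%:~R * ev p.
Proof. by rewrite /ev map_polyZ hornerZ. Qed.

Lemma ev_rVpoly N (r : 'rV[int]_N) : ev (rVpoly r) = \sum_j (r 0 j)%:~R * z ^+ j.
Proof.
rewrite /ev (@horner_coef_wide _ N); last first.
  by apply: leq_trans (size_poly _ _) _; rewrite size_poly.
by apply: eq_bigr => j _; rewrite coef_map /= coef_rVpoly_ord.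
Qed.

Lemma h_ge1 p : p != 0 -> 1 <= h p.
Proof. by move=> nz_p; rewrite ler1n hgt_gt0. Qed.

(** This is [norm_det_le] for the vector of powers of [z], whose entry of index 0 is 1, together
    with the fact that a nonzero integer is at least 1 in absolute value. *)
Lemma det_eval_lower_bound N (A : 'M[int]_N) (b : 'I_N -> F) : (0 < N)%N ->
    (forall i j, `|(A i j)%:~R| <= b i) -> \det A != 0 ->
  1 <= N`!%:R * \sum_i (\prod_(k | k != i) b k) * `|ev (rVpoly (row i A))|.
Proof.
move=> N_gt0 Ab nzA; pose B : 'M[F]_N := map_mx intr A.
pose v : 'cV[F]_N := \col_j z ^+ j.
have Bb k l : `|B k l| <= b k by rewrite mxE.
have := norm_det_le v (Ordinal N_gt0) Bb; rewrite [v _ _]mxE expr0 normr1 mulr1.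
rewrite det_map_mx /= => Hd; apply: (le_trans (norm_nonzero_intr_ge1 F nzA)).
apply: le_trans Hd _; rewrite ler_wpM2l //; apply: ler_sum => i _.
suff -> : (B *m v) i 0 = ev (rVpoly (row i A)) by [].
by rewrite ev_rVpoly mxE; apply: eq_bigr => j _; rewrite !mxE.
Qed.

Lemma rVpoly_row_Sylvester (p q : {poly int}) i : p != 0 -> q != 0 ->
  rVpoly (row i (Sylvester_mx p q)) =
    match split i with inl k => 'X^k * p | inr k => 'X^k * q end.
Proof.
move=> nz_p nz_q; have sp := polySpred nz_p; have sq := polySpred nz_q.
rewrite /Sylvester_mx; case: (split_ordP i) => k ->.
  rewrite rowKu rowE mul_rV_lin1 /= rVpoly_delta poly_rV_K //.
  rewrite size_monicM ?monicXn // size_polyXn; have := ltn_ord k.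
  by rewrite {1}sp addnS /= leq_add2r.
rewrite rowKd rowE mul_rV_lin1 /= rVpoly_delta poly_rV_K //.
rewrite size_monicM ?monicXn // size_polyXn; have lt_k := ltn_ord k.
by rewrite {1}sq addnS /= [leqRHS]addnC leq_add2r.
Qed.

(** The rows of the Sylvester matrix are shifts of [p] and [q], so their values at [z] are powers of
    [z] times [ev p] or [ev q]; leaving out a row lowers one exponent in the product of the row
    bounds. Heights are at least 1, so the degrees in the exponents may be replaced by their bounds
    [k] and [m]. *)
Lemma resultant_eval_lower_bound m k : (0 < m)%N -> (0 < k)%N ->
  exists2 C : F, 0 < C & forall p q : {poly int}, p != 0 -> q != 0 ->
    (size p <= m.+1)%N -> (size q <= k.+1)%N -> coprimep p q ->
  1 <= C * (h p ^+ k.-1 * h q ^+ m * `|ev p| + h p ^+ k * h q ^+ m.-1 * `|ev q|).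
Proof.
move=> m_gt0 k_gt0; pose Z := Num.max 1 `|z|.
have Z_ge1 : 1 <= Z by rewrite le_max lexx.
have Z_ge0 : 0 <= Z by apply: le_trans Z_ge1.
pose C := (m + k)`!%:R * ((m + k)%:R * Z ^+ (m + k)).
have C_ge1 : 1 <= C.
  rewrite /C; apply: mulr_ege1; first by rewrite ler1n fact_gt0.
  by apply: mulr_ege1; [rewrite ler1n addn_gt0 m_gt0 | rewrite exprn_ege1].
exists C => [|p q nz_p nz_q szp szq cpq]; first exact: lt_le_trans C_ge1.
have hp1 := h_ge1 nz_p; have hq1 := h_ge1 nz_q.
have hp0 : 0 < h p by apply: lt_le_trans hp1.
have hq0 : 0 < h q by apply: lt_le_trans hq1.
have sp := polySpred nz_p; have sq := polySpred nz_q.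
set dp := (size p).-1 in sp; set dq := (size q).-1 in sq.
have dqk : (dq <= k)%N by rewrite -ltnS -sq.
have dpm : (dp <= m)%N by rewrite -ltnS -sp.
pose E := h p ^+ k.-1 * h q ^+ m * `|ev p| + h p ^+ k * h q ^+ m.-1 * `|ev q|.
have tp0 : 0 <= h p ^+ k.-1 * h q ^+ m * `|ev p| by rewrite !mulr_ge0 ?exprn_ge0.
have tq0 : 0 <= h p ^+ k * h q ^+ m.-1 * `|ev q| by rewrite !mulr_ge0 ?exprn_ge0.
(* If both polynomials are constant, the Sylvester matrix is empty and the determinant bound does
   not apply; but then [ev p] is a nonzero integer. *)
rewrite -/E; have [dS0 | dS_gt0] := posnP (dq + dp).
  have sp1 : size p = 1%N by move/eqP: dS0; rewrite addn_eq0 sp => /andP[_ /eqP ->].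
  have [a nz_a Dp] := size_poly1P _ (introT eqP sp1).
  apply: mulr_ege1 => //; rewrite /E.
  apply: le_trans (_ : h p ^+ k.-1 * h q ^+ m * `|ev p| <= _); last by rewrite lerDl.
  have ap : ev p = a%:~R by rewrite Dp /ev map_polyC hornerC.
  by rewrite !mulr_ege1 ?exprn_ege1 // ap norm_nonzero_intr_ge1.
have nzS : \det (Sylvester_mx p q) != 0.
  by rewrite -/(resultant p q) resultant_eq0 -leqNgt (eqP cpq).
pose b (i : 'I_(dq + dp)) := match split i with inl _ => h p | inr _ => h q end.
have b_gt0 i : 0 < b i by rewrite /b; case: (split i).
have prodb : \prod_i b i = h p ^+ dq * h q ^+ dp.
  rewrite big_split_ord /=; congr (_ * _).
    rewrite (eq_bigr (fun=> h p)) => [|i _]; first by rewrite prodr_const card_ord.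
    by rewrite /b (unsplitK (inl i)).
  rewrite (eq_bigr (fun=> h q)) => [|i _]; first by rewrite prodr_const card_ord.
  by rewrite /b (unsplitK (inr i)).
have Sb i j : `|(Sylvester_mx p q i j)%:~R| <= b i.
  rewrite Sylvester_mxE /b.
  by case: (split i) => l; case: leqP => _;
    rewrite ?mulr0n ?mulr1n ?normr0 // norm_coef_le_hgt.
have := det_eval_lower_bound dS_gt0 Sb nzS => HS.
apply: le_trans HS _; rewrite /C -mulrA; apply: ler_pM => //.
- rewrite sumr_ge0 // => i _; rewrite mulr_ge0 // prodr_ge0 // => l _.
  exact: ltW.
- by rewrite ler_nat leq_fact // addnC leq_add.
apply: (@le_trans _ _ (\sum_(i < dq + dp) Z ^+ (m + k) * E)); last first.
  rewrite sumr_const card_ord -[leLHS]mulr_natl mulrA ler_wpM2r ?addr_ge0 //.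
  by rewrite ler_wpM2r ?exprn_ge0 // ler_nat addnC leq_add.
apply: ler_sum => i _; rewrite rVpoly_row_Sylvester //.
have := prodb; rewrite (bigD1 i) //= {1}/b.
have zX l : (l < m + k)%N -> `|z| ^+ l <= Z ^+ (m + k).
  move=> llt; apply: (@le_trans _ _ (Z ^+ l)).
    by rewrite lerXn2r ?nnegrE // le_max lexx orbT.
  by rewrite ler_weXn2l // ltnW.
case: (split i) => l Db; rewrite evM normrM.
  have dq_gt0 : (0 < dq)%N by apply: leq_ltn_trans (ltn_ord l).
  have -> : \prod_(j | j != i) b j = h p ^+ dq.-1 * h q ^+ dp.
    by apply: (mulfI (lt0r_neq0 hp0)); rewrite Db mulrA -exprS prednK.
  rewrite mulrCA /E {1}/ev map_polyXn hornerXn normrX.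
  apply: ler_pM; rewrite ?exprn_ge0 ?mulr_ge0 ?mulr_ge0 ?exprn_ge0 //.
    by apply: zX; rewrite ltn_addl // (leq_trans (ltn_ord l)).
  apply: le_trans (_ : h p ^+ k.-1 * h q ^+ m * `|ev p| <= _); last by rewrite lerDl.
  by rewrite ler_wpM2r //; apply: ler_pM; rewrite ?exprn_ge0 // ler_weXn2l // -!subn1 leq_sub2r.
have dp_gt0 : (0 < dp)%N by apply: leq_ltn_trans (ltn_ord l).
have -> : \prod_(j | j != i) b j = h p ^+ dq * h q ^+ dp.-1.
  apply: (mulfI (lt0r_neq0 hq0)); rewrite Db mulrCA -exprS prednK //.
rewrite mulrCA /E {1}/ev map_polyXn hornerXn normrX.
apply: ler_pM; rewrite ?exprn_ge0 ?mulr_ge0 ?mulr_ge0 ?exprn_ge0 //.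
  by apply: zX; rewrite ltn_addr // (leq_trans (ltn_ord l)).
apply: le_trans (_ : h p ^+ k * h q ^+ m.-1 * `|ev q| <= _); last by rewrite lerDr.
by rewrite ler_wpM2r //; apply: ler_pM; rewrite ?exprn_ge0 // ler_weXn2l // -!subn1 leq_sub2r.
Qed.

End Evaluation.

(** * Coprimality forced by small values *)

Section LowerBounds.
Variables (F : realFieldType) (z : F).
Local Notation ev := (ev z).
Local Notation h p := ((hgt p)%:R : F).

Definition small_values n := forall C : F, exists T : nat, forall X : nat,
  (T <= X)%N -> exists p : {poly int}, [/\ p != 0, (size p <= n.+1)%N,
    (hgt p <= X)%N & C * X%:R ^+ (n.-1).*2 * `|ev p| <= 1].

Definition bounded_below := forall n T : nat, exists2 c : F, 0 < c &
  forall p : {poly int}, p != 0 -> (size p <= n)%N -> (hgt p <= T)%N -> c <= `|ev p|.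

(** The gcd matters only up to constants; its primitive part divides [p] and [q] exactly over the
    integers, by Gauss's lemma. *)
Lemma zprimitive_gcdp_factors (p q : {poly int}) : p != 0 -> q != 0 ->
  exists g a b : {poly int}, [/\ p = g * a, q = g * b, coprimep a b,
    [/\ g != 0, a != 0 & b != 0] & size g = size (gcdp p q)].
Proof.
move=> nz_p nz_q; set d := gcdp p q; pose g := zprimitive d.
have [a Da] := dvdpP_int (dvdp_gcdl p q); have [b Db] := dvdpP_int (dvdp_gcdr p q).
rewrite -/d -/g in Da Db.
have nz_g : g != 0 by apply: contraNneq nz_p => g0; rewrite Da g0 mul0r.
have nz_a : a != 0 by apply: contraNneq nz_p => a0; rewrite Da a0 mulr0.
have nz_b : b != 0 by apply: contraNneq nz_q => b0; rewrite Db b0 mulr0.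
have sg : size g = size d by rewrite size_zprimitive.
exists g, a, b; split => //.
rewrite coprimep_def; have := eqp_size (mulp_gcdr a b g).
rewrite -Da -Db -/d -sg size_mul // ?gcdp_eq0 ?negb_and ?nz_a //.
have : (0 < size g)%N by rewrite size_poly_gt0.
have : (0 < size (gcdp a b))%N by rewrite size_poly_gt0 gcdp_eq0 negb_and nz_a.
by move: (size g) (size _) => x y; clear; lia.
Qed.

Lemma size_factorl (p q : {poly int}) : p * q != 0 -> (size p <= size (p * q)%R)%N.
Proof.
rewrite mulf_eq0 negb_or => /andP[nz_p nz_q]; rewrite size_mul //.
have : (0 < size q)%N by rewrite size_poly_gt0.
by move: (size p) (size q) => x y; clear; lia.
Qed.

Lemma hgt_factorl n C : (forall p q : {poly int},
    (size p <= n.+1)%N -> (size q <= n.+1)%N ->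
    (hgt p * hgt q <= C * hgt (p * q)%R)%N) ->
  forall p q : {poly int}, p * q != 0 -> (size (p * q)%R <= n.+1)%N ->
  (hgt p * hgt q <= C * hgt (p * q)%R)%N /\ (hgt p <= C * hgt (p * q)%R)%N.
Proof.
move=> gel p q nz_pq sz.
have nz : p != 0 /\ q != 0 by apply/andP; rewrite -negb_or -mulf_eq0.
have szp := leq_trans (size_factorl nz_pq) sz.
have szq : (size q <= n.+1)%N.
  by rewrite mulrC in nz_pq sz; apply: leq_trans (size_factorl nz_pq) sz.
have H := gel _ _ szp szq; split => //; apply: leq_trans H.
by rewrite leq_pmulr // hgt_gt0; case: nz.
Qed.

(* An irreducible [r] of degree [d] cannot divide the small polynomial [p] found at
   height slightly below [hgt r], so their resultant bounds [ev r] from below;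
   reducible polynomials follow by multiplicativity. *)
Lemma eval_lower_bound n d : small_values n -> bounded_below -> (d < n)%N ->
  exists2 c : F, 0 < c & forall r : {poly int}, r != 0 -> (size r <= d.+1)%N ->
    c <= `|ev r| * h r ^+ (d + n.-1).
Proof.
move=> small below; elim: d => [|d IHd] lt_dn.
  exists 1 => // r nz_r /size1_polyC Dr; set a := r`_0 in Dr.
  have nz_a : a != 0 by apply: contraNneq nz_r => a0; rewrite Dr a0.
  have -> : ev r = a%:~R by rewrite Dr /ev map_polyC hornerC.
  by rewrite mulr_ege1 ?norm_nonzero_intr_ge1 ?exprn_ege1 ?h_ge1.
have n_gt0 : (0 < n)%N by apply: leq_ltn_trans lt_dn.
have [c0 c0_gt0 Hc0] := IHd (ltnW lt_dn).
have [Cg Cg_gt0 gel] := gelfond n.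
have [C1 C1_gt0 res] := resultant_eval_lower_bound z (ltn0Sn d) n_gt0.
(* With [h r <= 2 * Cg * X] below, this constant makes the [ev p] term of the resultant inequality
   at most one half. *)
have [T HT] := small (2 * C1 * (2 * Cg%:R) ^+ n).
have [c2 c2_gt0 Hc2] := below d.+2 (Cg * T.+1)%N.
pose e := (d + n.-1)%N.
pose c3 := c0 ^+ 2 / Cg%:R ^+ e.
have Cg0 : 0 < Cg%:R :> F by rewrite ltr0n.
have c3_gt0 : 0 < c3 by rewrite divr_gt0 ?exprn_gt0.
pose c := Num.min (Num.min c0 c2) (Num.min (2 * C1)^-1 c3).
have c_gt0 : 0 < c by rewrite !lt_min c0_gt0 c2_gt0 c3_gt0 invr_gt0 mulr_gt0.
have [cc0 cc2 cc1 cc3] : [/\ c <= c0, c <= c2, c <= (2 * C1)^-1 & c <= c3].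
  by rewrite /c; split; rewrite !ge_min lexx ?orbT.
rewrite addSn -/e.
have weaken x (r : {poly int}) : r != 0 -> c <= x -> x <= `|ev r| * h r ^+ e ->
    c <= `|ev r| * h r ^+ e.+1.
  move=> nz_r cx xr; apply: le_trans cx (le_trans xr _).
  by rewrite ler_wpM2l // ler_weXn2l // h_ge1.
exists c => //.
(* Passing to the primitive part increases neither the value nor the height, and for a primitive [r]
   divisibility of [p] over the rationals gives an integer quotient. *)
suff Hprim (r : {poly int}) : r != 0 -> zprimitive r = r -> (size r <= d.+2)%N ->
    c <= `|ev r| * h r ^+ e.+1.
  move=> r nz_r sz_r; have nz_pr : zprimitive r != 0 by rewrite zprimitive_eq0.
  have nz_ct : zcontents r != 0 by rewrite zcontents_eq0.
  have := Hprim _ nz_pr (zprimitive_id r); rewrite size_zprimitive => /(_ sz_r) Hr.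
  apply: le_trans Hr _; rewrite [in leRHS](zpolyEprim r) evZ hgtZ normrM natrM.
  apply: ler_pM; rewrite ?exprn_ge0 //.
    by rewrite ler_peMl // norm_nonzero_intr_ge1.
  by rewrite lerXn2r ?nnegrE ?mulr_ge0 // ler_peMl // ler1n absz_gt0.
move=> nz_r prim_r sz_r; have hr1 := h_ge1 F nz_r.
have [small_r | big_r] := leqP (hgt r) (Cg * T.+1).
  apply: le_trans cc2 _; apply: le_trans (Hc2 _ nz_r sz_r small_r) _.
  by rewrite ler_peMr // exprn_ege1.
(* The largest [X] with [Cg * X < hgt r]: by Gelfond's inequality, a nonzero multiple of [r] of
   degree at most [n] has height above [X]. *)
pose X := ((hgt r).-1 %/ Cg)%N.
have TX : (T < X)%N by rewrite /X leq_divRL // mulnC -ltnS prednK // (leq_trans _ big_r).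
have XC : (X * Cg < hgt r)%N.
  by apply: leq_ltn_trans (leq_trunc_div _ _) _; rewrite ltn_predL hgt_gt0.
have rX : h r <= 2 * Cg%:R * X%:R.
  rewrite -!natrM ler_nat.
  apply: (@leq_trans (X.+1 * Cg)).
    by rewrite -{1}(prednK (hgt_gt0 nz_r)) -ltn_divLR.
  rewrite mulnAC leq_pmul2r // mul2n -addnn -addn1 leq_add2l.
  exact: leq_ltn_trans TX.
have [p [nz_p sz_p pX evp]] := HT X (ltnW TX).
have X1 : 1 <= X%:R :> F by rewrite ler1n; apply: leq_ltn_trans TX.
have X0 : 0 <= X%:R :> F by [].
have [cop | ncop] := boolP (coprimep r p).
  have := res r p nz_r nz_p sz_r sz_p cop; rewrite /= => Hres.
  have hpX : h p <= X%:R by rewrite ler_nat.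
  have t2 : 2 * C1 * (h r ^+ n * h p ^+ d * `|ev p|) <= 1.
    apply: le_trans evp; rewrite -!mulrA ler_pM2l // ler_pM2l // !mulrA.
    rewrite ler_wpM2r //; apply: (@le_trans _ _ ((2 * Cg%:R * X%:R) ^+ n * X%:R ^+ d)).
      apply: ler_pM; rewrite ?exprn_ge0 // lerXn2r ?nnegrE // !mulr_ge0 //.
    rewrite exprMn -mulrA -exprD ler_wpM2l ?exprn_ge0 ?mulr_ge0 //.
    by rewrite ler_weXn2l // -addnn -{1}(prednK n_gt0) addSnnS leq_add2l -ltnS prednK.
  have t1 : C1 * (h r ^+ n.-1 * h p ^+ d.+1 * `|ev r|) <= C1 * (`|ev r| * h r ^+ e.+1).
    rewrite ler_pM2l // mulrC ler_wpM2l // /e -addSn addnC exprD.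
    rewrite ler_wpM2l ?exprn_ge0 // lerXn2r ?nnegrE //.
    apply: le_trans hpX _; rewrite ler_nat ltnW //.
    by apply: leq_ltn_trans XC; rewrite leq_pmulr.
  apply: le_trans cc1 _; rewrite -(ler_pM2l (_ : 0 < 2 * C1)) ?mulr_gt0 //.
  rewrite divff ?mulf_neq0 ?lt0r_neq0 //; move: Hres; rewrite mulrDr.
  move: t1 t2; rewrite -!mulrA.
  move: (C1 * _) (C1 * _) (C1 * _) => u v w; clear; lra.
have [g [a [b [Dr Dp _ [nz_g nz_a nz_b] sg]]]] := zprimitive_gcdp_factors nz_r nz_p.
have sg2 : (1 < size g)%N.
  have : (0 < size g)%N by rewrite size_poly_gt0.
  by move: ncop; rewrite coprimep_def -sg; move: (size g) => x; clear; lia.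
have sra : size r = (size g + size a).-1 by rewrite Dr size_mul.
(* A proper common factor gives [r = g * a] with both degrees at most [d]; the two inductive bounds
   multiply, and Gelfond's inequality costs [Cg ^+ e]. *)
have [proper | full] := leqP (size g) d.+1.
  apply: (weaken c3) => //; rewrite /c3 ler_pdivrMr ?exprn_gt0 //.
  have sz_a : (size a <= d.+1)%N.
    by move: sra sz_r sg2; move: (size r) (size g) (size a) => x y w; clear; lia.
  have := ler_pM (ltW c0_gt0) (ltW c0_gt0) (Hc0 _ nz_g proper) (Hc0 _ nz_a sz_a).
  rewrite -expr2 => /le_trans; apply.
  rewrite mulrACA -normrM -evM -Dr -exprMn -mulrA -exprMn ler_wpM2l //.
  rewrite lerXn2r ?nnegrE ?mulr_ge0 // -!natrM ler_nat [leqRHS]mulnC Dr.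
  have nz_ga : g * a != 0 by rewrite -Dr.
  have sz_ga : (size (g * a)%R <= n.+1)%N.
    by rewrite -Dr (leq_trans sz_r) // leqW.
  exact: (hgt_factorl gel nz_ga sz_ga).1.
have : r %| p.
  have: gcdp r p %= r.
    rewrite -dvdp_size_eqp ?dvdp_gcdl // -sg.
    have : (size g <= size r)%N by rewrite Dr size_factorl // -Dr.
    by move: full sz_r; move: (size r) (size g) => x y; clear; lia.
  by move/eqp_dvdl=> <-; exact: dvdp_gcdr.
move/dvdpP_int=> [s]; rewrite prim_r => Dps.
rewrite Dps in nz_p sz_p; have := (hgt_factorl gel nz_p sz_p).2; rewrite -Dps => hrp.
by have := leq_ltn_trans hrp (leq_ltn_trans _ XC);
   rewrite mulnC leq_pmul2r // ltnn => /(_ pX).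
Qed.

(** Write [p = g * a] and [q = g * b]. The resultant of [a] and [b] bounds [ev g] from above in
    terms of [ev p], while [eval_lower_bound] bounds it from below; comparing the two gives the
    claim. *)
Lemma gcd_value_lower_bound n d : small_values n -> bounded_below ->
    (0 < d)%N -> (d < n)%N ->
  exists2 C : F, 0 < C & forall p q : {poly int}, p != 0 -> q != 0 ->
    (size p <= n.+1)%N -> (size q <= n.+1)%N -> (hgt p <= hgt q)%N ->
    `|ev q| <= `|ev p| -> size (gcdp p q) = d.+1 ->
  1 <= C * (h q ^+ (n.-1).*2 * `|ev p|).
Proof.
move=> small below d_gt0 lt_dn; pose m := (n - d)%N.
have m_gt0 : (0 < m)%N by rewrite subn_gt0.
have [c c_gt0 Hc] := eval_lower_bound small below lt_dn.
have [Cg Cg_gt0 gel] := gelfond n.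
have [C1 C1_gt0 res] := resultant_eval_lower_bound z m_gt0 m_gt0.
have Cg0 : 0 < Cg%:R :> F by rewrite ltr0n.
exists (2 * C1 * Cg%:R ^+ (n.-1).*2 / c).
  by rewrite divr_gt0 ?mulr_gt0 ?exprn_gt0.
move=> p q nz_p nz_q sz_p sz_q hpq evpq sz_gcd.
have [g [a [b [Dp Dq cop [nz_g nz_a nz_b] sg]]]] := zprimitive_gcdp_factors nz_p nz_q.
rewrite sz_gcd in sg; pose Y := Cg%:R * h q; have Y0 : 0 <= Y by rewrite mulr_ge0.
have cofactor_size (r s : {poly int}) :
    r != 0 -> s != 0 -> r = g * s -> (size r <= n.+1)%N -> (size s <= m.+1)%N.
  move=> nz_r nz_s ->; rewrite size_mul // sg addSn /= => sz.
  have dn := ltnW lt_dn.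
  by rewrite /m -subSn // leq_subRL // leqW.
have sz_a := cofactor_size _ _ nz_p nz_a Dp sz_p.
have sz_b := cofactor_size _ _ nz_q nz_b Dq sz_q.
have factor_le (r s : {poly int}) : r != 0 -> r = g * s -> (size r <= n.+1)%N ->
    (hgt r <= hgt q)%N -> h g * h s <= Y /\ h g <= Y.
  move=> nz_r Dr sz_r rq; rewrite Dr in nz_r sz_r.
  have [H1 H2] := hgt_factorl gel nz_r sz_r; rewrite -Dr in H1 H2.
  rewrite /Y -!natrM !ler_nat; split.
    by apply: leq_trans H1 _; rewrite leq_mul2l rq orbT.
  by apply: leq_trans H2 _; rewrite leq_mul2l rq orbT.
have [gaY gY] := factor_le _ _ nz_p Dp sz_p hpq.
have [gbY _] := factor_le _ _ nz_q Dq sz_q (leqnn _).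
have hg1 := h_ge1 F nz_g; have Y1 : 1 <= Y by apply: le_trans gY.
have hg0 : 0 < h g by apply: lt_le_trans hg1.
pose k := m.-1; have Dm : m = k.+1 by rewrite prednK.
(* The resultant inequality for [a] and [b] is multiplied by [h g ^+ (k + m)] and by the absolute
   value of [ev g]: each [h g] pairs with a height of [a] or [b], for a product at most [Y], and
   [ev g] turns the values of [a] and [b] into those of [p] and [q]. *)
have step1 : h g ^+ (k + m) * `|ev g| <= C1 * (2 * (Y ^+ (k + m) * `|ev p|)).
  have E0 : 0 <= h g ^+ (k + m) * `|ev g| by rewrite mulr_ge0 ?exprn_ge0.
  have := ler_wpM2l E0 (res _ _ nz_a nz_b sz_a sz_b cop); rewrite mulr1.
  move/le_trans; apply; rewrite mulrCA ler_pM2l // mulrDr mulr2n mulrDl !mul1r.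
  have E1 u v s t : h g * h s <= Y -> h g * h t <= Y ->
     h g ^+ (u + v) * `|ev g| * (h s ^+ u * h t ^+ v * `|ev s|) <=
     Y ^+ (u + v) * `|ev (g * s)|.
    move=> sY tY; have -> : h g ^+ (u + v) * `|ev g| * (h s ^+ u * h t ^+ v * `|ev s|) =
      (h g * h s) ^+ u * (h g * h t) ^+ v * `|ev (g * s)|.
      by rewrite evM normrM exprD !exprMn; ring.
    rewrite ler_wpM2r // exprD; apply: ler_pM; rewrite ?exprn_ge0 ?mulr_ge0 //.
      by rewrite lerXn2r ?nnegrE ?mulr_ge0.
    by rewrite lerXn2r ?nnegrE ?mulr_ge0.
  apply: lerD; first by rewrite Dp; apply: E1.
  apply: (@le_trans _ _ (Y ^+ (k + m) * `|ev q|)); last by rewrite ler_wpM2l ?exprn_ge0.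
  by rewrite Dq [h a ^+ m * _]mulrC; apply: E1.
have Hcg : c <= `|ev g| * h g ^+ (d + n.-1) by apply: Hc; rewrite ?sg.
(* Surplus powers of [h g] are traded for powers of [Y], which is at least [h g]; here [0 < d < n]
   keeps both [d + n.-1] and [k + m] at most [2n - 2]. *)
have expo : h g ^+ (d + n.-1) * Y ^+ (k + m) <= h g ^+ (k + m) * Y ^+ (n.-1).*2.
  have [le1 | lt1] := leqP (d + n.-1) (k + m).
    apply: ler_pM; rewrite ?exprn_ge0 // ler_weXn2l // -addnn leq_add //.
      by rewrite /k /m -!subn1 leq_sub2r // leq_subr.
    by rewrite /m -subn1 leq_sub2l.
  rewrite -(subnK (ltnW lt1)) addnC exprD -mulrA ler_pM2l ?exprn_gt0 //.
  apply: (@le_trans _ _ (Y ^+ (d + n.-1))).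
    rewrite -[in leRHS](subnK (ltnW lt1)) [leRHS]exprD ler_wpM2r ?exprn_ge0 //.
    by rewrite lerXn2r ?nnegrE.
  by rewrite ler_weXn2l // -addnn leq_add2r -ltnS prednK // (leq_ltn_trans _ lt_dn).
have fin : c <= 2 * C1 * (Y ^+ (n.-1).*2 * `|ev p|).
  rewrite -(ler_pM2r (exprn_gt0 (k + m) hg0)).
  apply: le_trans (ler_wpM2r (exprn_ge0 _ (ltW hg0)) Hcg) _.
  rewrite mulrAC [_ * h g ^+ (k + m)]mulrC.
  apply: le_trans (ler_wpM2r (exprn_ge0 (d + n.-1) (ltW hg0)) step1) _.
  have -> : C1 * (2 * (Y ^+ (k + m) * `|ev p|)) * h g ^+ (d + n.-1) =
    2 * C1 * `|ev p| * (h g ^+ (d + n.-1) * Y ^+ (k + m)) by ring.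
  have -> : 2 * C1 * (Y ^+ (n.-1).*2 * `|ev p|) * h g ^+ (k + m) =
    2 * C1 * `|ev p| * (h g ^+ (k + m) * Y ^+ (n.-1).*2) by ring.
  by rewrite ler_wpM2l // !mulr_ge0 // ltW.
rewrite mulrAC ler_pdivlMr // mul1r; move: fin; rewrite /Y exprMn.
by rewrite -!mulrA.
Qed.

(** The previous constant depends on the degree of the gcd; over finitely many degrees the sum of
    the constants serves all of them. *)
Lemma uniform_constant (P : nat -> F -> Prop) n :
    (forall d C D, P d C -> C <= D -> P d D) ->
    (forall d, (d < n)%N -> exists2 C, 0 < C & P d C) ->
  exists2 C, 0 < C & forall d, (d < n)%N -> P d C.
Proof.
move=> mono; elim: n => [|n IHn] H; first by exists 1.
have [C C0 HC] := IHn (fun d lt_dn => H d (ltnW lt_dn)).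
have [D D0 HD] := H n (ltnSn n).
exists (C + D) => [|d]; first by rewrite addr_gt0.
rewrite ltnS leq_eqVlt => /orP[/eqP-> | lt_dn].
  by apply: mono HD _; rewrite lerDr ltW.
by apply: mono (HC d lt_dn) _; rewrite lerDl ltW.
Qed.

(** A gcd of degree strictly between 0 and [n] contradicts [gcd_value_lower_bound]. If the degree is
    [n], then [p] and [q] are integer multiples of one polynomial, so the order of their heights is
    that of their values, against the strict inequality. *)
Lemma coprimep_of_small_value n : small_values n -> bounded_below ->
  exists2 C : F, 0 < C & forall p q : {poly int}, p != 0 -> q != 0 ->
    (size p <= n.+1)%N -> (size q <= n.+1)%N -> (hgt p <= hgt q)%N ->
    `|ev q| < `|ev p| -> C * (h q ^+ (n.-1).*2 * `|ev p|) < 1 -> coprimep p q.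
Proof.
move=> small below.
have [|d lt_dn|C C0 HC] := @uniform_constant (fun d C => (0 < d)%N ->
  forall p q : {poly int}, p != 0 -> q != 0 ->
    (size p <= n.+1)%N -> (size q <= n.+1)%N -> (hgt p <= hgt q)%N ->
    `|ev q| <= `|ev p| -> size (gcdp p q) = d.+1 ->
  1 <= C * (h q ^+ (n.-1).*2 * `|ev p|)) n.
- move=> d C D HC CD d_gt0 p q nz_p nz_q sz_p sz_q hpq evpq sg.
  apply: le_trans (HC d_gt0 p q nz_p nz_q sz_p sz_q hpq evpq sg) _.
  by rewrite ler_wpM2r // mulr_ge0 ?exprn_ge0.
- have [-> | d_gt0] := posnP d; first by exists 1.
  by have [C C0 HC] := gcd_value_lower_bound small below d_gt0 lt_dn; exists C.
exists C => // p q nz_p nz_q sz_p sz_q hpq evpq; apply: contraTT => ncop.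
rewrite -leNgt.
have sg_gt0 : (0 < size (gcdp p q))%N by rewrite size_poly_gt0 gcdp_eq0 negb_and nz_p.
have sg_gt1 : (1 < size (gcdp p q))%N by rewrite ltn_neqAle eq_sym -coprimep_def ncop.
pose d := (size (gcdp p q)).-1; have Dd : size (gcdp p q) = d.+1 by rewrite prednK.
have d_gt0 : (0 < d)%N by rewrite -ltnS -Dd.
have [lt_dn | le_nd] := ltnP d n; first by apply: (HC d) => //; exact: ltW.
have [g [a [b [Dp Dq _ [nz_g nz_a nz_b] sg]]]] := zprimitive_gcdp_factors nz_p nz_q.
have const (r s : {poly int}) : s != 0 -> r = g * s -> (size r <= n.+1)%N ->
    exists2 x : int, hgt r = (absz x * hgt g)%N & `|ev r| = (absz x)%:R * `|ev g|.
  move=> nz_s Dr; rewrite Dr size_mul // sg Dd addSn /= => sz_s.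
  have /size1_polyC Ds : (size s <= 1)%N.
    by rewrite -(leq_add2l d) addn1 (leq_trans sz_s) // ltnS.
  exists s`_0; first by rewrite [in LHS]Ds mulrC mul_polyC hgtZ.
  rewrite {1}Ds mulrC mul_polyC evZ normrM; congr (_ * _).
  by rewrite -intr_norm -abszE.
have [x Hp Ep] := const _ _ nz_a Dp sz_p; have [y Hq Eq] := const _ _ nz_b Dq sz_q.
move: hpq evpq; rewrite Hp Hq Ep Eq leq_pmul2r ?hgt_gt0 // => xy.
by rewrite ltNge ler_wpM2r // ler_nat.
Qed.

(** The polynomials are coprime, and as [q] has the larger height and the smaller value, the second
    term of their resultant inequality is at most the first. The constant [C + 2 * D] covers both
    the coprimality condition and this doubling. *)
Lemma consecutive_height_bound n : (0 < n)%N -> small_values n -> bounded_below ->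
  exists2 C : F, 0 < C & forall p q : {poly int}, p != 0 -> q != 0 ->
    (size p <= n.+1)%N -> (size q <= n.+1)%N -> (hgt p <= hgt q)%N ->
    `|ev q| < `|ev p| -> C * (h q ^+ (n.-1).*2 * `|ev p|) < 1 ->
  1 <= C * (h p ^+ n.-1 * h q ^+ n * `|ev p|).
Proof.
move=> n_gt0 small below.
have [C C0 HC] := coprimep_of_small_value small below.
have [D D0 res] := resultant_eval_lower_bound z n_gt0 n_gt0.
exists (C + 2 * D) => [|p q nz_p nz_q sz_p sz_q hpq evpq smallp].
  by rewrite addr_gt0 ?mulr_gt0.
have cop : coprimep p q.
  apply: HC => //; apply: le_lt_trans smallp.
  by rewrite ler_wpM2r ?mulr_ge0 ?exprn_ge0 // lerDl mulr_ge0 // ltW.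
apply: le_trans (res p q nz_p nz_q sz_p sz_q cop) _.
pose E := h p ^+ n.-1 * h q ^+ n * `|ev p|.
have E0 : 0 <= E by rewrite !mulr_ge0 ?exprn_ge0.
have E2 : h p ^+ n * h q ^+ n.-1 * `|ev q| <= E.
  rewrite /E -{1 4}(prednK n_gt0) !exprS -!mulrA mulrCA ler_wpM2l ?exprn_ge0 //.
  apply: ler_pM; rewrite ?mulr_ge0 ?exprn_ge0 ?ler_nat //.
  by rewrite ler_wpM2l ?exprn_ge0 // ltW.
rewrite -/E; apply: (@le_trans _ _ (D * (E + E))).
  by rewrite ler_pM2l // lerD2l.
have -> : D * (E + E) = 2 * D * E by ring.
by rewrite ler_wpM2r // lerDr ltW.
Qed.

End LowerBounds.

(** * Transfer to coefficient functions over [Z] *)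

Definition poly_of_zpoly n (P : zpoly) : {poly int} := \poly_(i < n.+1) int_of_Z (P i).

Lemma IZR_int_of_Z a : IZR a = (int_of_Z a)%:~R.
Proof.
rewrite -{1}[a]int_of_ZK; case: (int_of_Z a) => m.
  by rewrite -INR_IZR_INZ INRE.
by rewrite /= opp_IZR -INR_IZR_INZ INRE addn1 NegzE mulrNz.
Qed.

Lemma peval_ev n P z : peval n P z = ev z (poly_of_zpoly n P).
Proof.
rewrite /peval sum_f_R0E big_mkord /ev (@horner_coef_wide _ n.+1); last first.
  by apply: leq_trans (size_poly _ _) (size_poly _ _).
apply: eq_bigr => i _; rewrite coef_map coef_poly ltn_ord /=.
by rewrite IZR_int_of_Z RpowE.
Qed.

Lemma absz_int_of_Z a : absz (int_of_Z a) = Z.to_nat (Z.abs a).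
Proof. lia. Qed.

Lemma height_attained n P : exists2 i, (i <= n)%N & height n P = Z.abs (P i).
Proof.
elim: n => [|n [i le_in Hi]] /=; first by exists 0%N.
case: (Z.max_spec (height n P) (Z.abs (P n.+1))) => -[_ ->].
  by exists n.+1.
by exists i; rewrite // leqW.
Qed.

Lemma hgt_poly_of_zpoly n P : hgt (poly_of_zpoly n P) = Z.to_nat (height n P).
Proof.
apply/eqP; rewrite eqn_leq; apply/andP; split.
  apply: hgt_le => i; rewrite coef_poly; case: ltnP => // lt_in.
  rewrite absz_int_of_Z; have := coef_le_height n P i (elimT (@ssrnat.leP i n) lt_in); lia.
have [i le_in ->] := height_attained n P.
have := coef_le_hgt (poly_of_zpoly n P) i.
by rewrite coef_poly ltnS le_in absz_int_of_Z.
Qed.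

Lemma IZR_height n P : IZR (height n P) = (hgt (poly_of_zpoly n P))%:R.
Proof.
by rewrite hgt_poly_of_zpoly -INRE INR_IZR_INZ Z2Nat.id //; apply: height_nonneg.
Qed.

Lemma size_poly_of_zpoly n P : (size (poly_of_zpoly n P) <= n.+1)%N.
Proof. exact: size_poly. Qed.

Lemma poly_of_zpoly_neq0 n P : nonzero_le n P -> poly_of_zpoly n P != 0.
Proof.
move=> [i [/ssrnat.leP le_in nzP]]; apply/eqP => /(congr1 (fun p : {poly int} => p`_i)).
by rewrite coef_poly ltnS le_in coef0 => e; apply: nzP; rewrite -[P i]int_of_ZK e.
Qed.

Definition zpoly_of_poly (p : {poly int}) : zpoly := fun i => Z_of_int p`_i.

Lemma zpoly_of_polyK n (p : {poly int}) : (size p <= n.+1)%N ->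
  poly_of_zpoly n (zpoly_of_poly p) = p.
Proof.
move=> sz; apply/polyP => i; rewrite coef_poly /zpoly_of_poly Z_of_intK.
by case: ltnP => // le_ni; rewrite nth_default // (leq_trans sz).
Qed.

Lemma nonzero_le_zpoly_of_poly n (p : {poly int}) : p != 0 -> (size p <= n.+1)%N ->
  nonzero_le n (zpoly_of_poly p).
Proof.
move=> nz_p sz; exists (size p).-1; split.
  by apply/ssrnat.leP; rewrite -ltnS prednK // size_poly_gt0.
rewrite /zpoly_of_poly => e; have : lead_coef p == 0 by rewrite lead_coefE -[p`__]Z_of_intK e.
by rewrite lead_coef_eq0 (negbTE nz_p).
Qed.

Lemma deg_le_zpoly_of_poly n (p : {poly int}) : (size p <= n.+1)%N ->
  deg_le (zpoly_of_poly p) n.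
Proof.
by move=> sz i /ssrnat.ltP lt_ni; rewrite /zpoly_of_poly nth_default // (leq_trans sz).
Qed.

Lemma consecutive_height_bound_zpoly n z : (1 <= n)%coq_nat ->
    values_bounded_below z -> has_small_values n z ->
  exists C : R, (0 < C)%coqR /\ forall P Q : zpoly, nonzero_le n P -> nonzero_le n Q ->
    Z.le (height n P) (height n Q) -> (Rabs (peval n Q z) < Rabs (peval n P z))%coqR ->
    (C * (IZR (height n Q) ^ (2 * (n - 1)%coq_nat)%coq_nat * Rabs (peval n P z)) < 1)%coqR ->
  (1 <= C * (IZR (height n P) ^ (n - 1)%coq_nat * IZR (height n Q) ^ n *
    Rabs (peval n P z)))%coqR.
Proof.
move=> /ssrnat.leP n_gt0 below small.
have small' : small_values z n.
  move=> C; have [T HT] := small C; exists T => X /ssrnat.leP TX.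
  have [P [nzP [PX small_P]]] := HT X TX; exists (poly_of_zpoly n P); split.
  - exact: poly_of_zpoly_neq0.
  - exact: size_poly_of_zpoly.
  - by move/RleP: PX; rewrite IZR_height INRE ler_nat.
  - move/RleP: small_P; rewrite RabsE peval_ev INRE RpowE minusE multE.
    by rewrite -mul2n -subn1.
have below' : bounded_below z.
  (* [bounded_below] bounds the size, so [k.+1] stands for degree [k], and size 0 leaves only the
     zero polynomial. *)
  move=> [|k] T.
    exists 1 => // p nz_p; rewrite leqn0 size_poly_eq0 (negbTE nz_p) //.
  have [c [c0 Hc]] := below k (Z.of_nat T); exists c; first exact/RltP.
  move=> p nz_p sz_p hp.
  have := Hc _ (deg_le_zpoly_of_poly sz_p) (nonzero_le_zpoly_of_poly nz_p sz_p).
  rewrite peval_ev zpoly_of_polyK // => H.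
  apply/RleP; rewrite -RabsE; apply: H.
  have := hgt_poly_of_zpoly k (zpoly_of_poly p); rewrite zpoly_of_polyK // => e.
  have := height_nonneg k (zpoly_of_poly p); move/ssrnat.leP: hp; rewrite e.
  move: (height _ _) => x; clear; lia.
have [C C0 HC] := consecutive_height_bound n_gt0 small' below'.
exists C; split; first exact/RltP.
move=> P Q nzP nzQ hPQ evPQ; rewrite minusE multE => smallP.
have := HC (poly_of_zpoly n P) (poly_of_zpoly n Q) (poly_of_zpoly_neq0 nzP)
  (poly_of_zpoly_neq0 nzQ) (size_poly_of_zpoly n P) (size_poly_of_zpoly n Q).
rewrite -!IZR_height -!peval_ev -!RabsE !hgt_poly_of_zpoly -subn1 -!RpowE -mul2n => H.
apply/RleP/H.
- by apply/ssrnat.leP; move: (height _ _) (height _ _) hPQ => x y; clear; lia.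
- exact/RltP.
- exact/RltP.
Qed.

(** A left kernel vector of the coefficient matrix would be a linear relation, so the determinant is
    a nonzero integer; each of the [n.+1] rows then contributes at most [H ^ n * L] to
    [det_eval_lower_bound]. *)
Lemma lin_indep_height_bound n z : exists C : R, (0 < C)%coqR /\
  forall (G : nat -> zpoly) (H L : R), lin_indep n G -> (0 <= H)%coqR ->
    (forall i, (i <= n)%coq_nat -> (IZR (height n (G i)) <= H)%coqR) ->
    (forall i, (i <= n)%coq_nat -> (Rabs (peval n (G i) z) <= L)%coqR) ->
  (1 <= C * (H ^ n * L))%coqR.
Proof.
exists (n.+1`! * n.+1)%:R; split.
  by apply/RltP; rewrite ltr0n muln_gt0 fact_gt0.
move=> G H L indep H0 GH GL.
pose A : 'M[int]_n.+1 := \matrix_(i, j) int_of_Z (G i j).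
have nzA : \det A != 0.
  apply/eqP => A0; have : \det (map_mx intr A : 'M[R]_n.+1) = 0 by rewrite det_map_mx A0.
  move/eqP/det0P => [v nz_v vA]; case/negP: nz_v; apply/eqP/rowP => j; rewrite mxE.
  pose c k := if insub k is Some i then v 0 i else 0.
  have cE (i : 'I_n.+1) : c i = v 0 i by rewrite /c valK.
  rewrite -cE; apply: indep; last by apply/ssrnat.leP; rewrite -ltnS.
  move=> i /ssrnat.leP le_in; have /rowP/(_ (Ordinal (le_in : (i < n.+1)%N))) := vA.
  rewrite !mxE sum_f_R0E big_mkord => e; apply: etrans e; apply: eq_bigr => k _.
  by rewrite !mxE cE IZR_int_of_Z.
have Ab i j : `|(A i j)%:~R| <= H :> R.
  rewrite mxE; apply: le_trans (_ : (hgt (poly_of_zpoly n (G i)))%:R <= _).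
    have := norm_coef_le_hgt R (poly_of_zpoly n (G i)) j.
    by rewrite coef_poly ltn_ord.
  by rewrite -IZR_height; apply/RleP/GH/ssrnat.leP; rewrite -ltnS.
have := det_eval_lower_bound z (ltn0Sn n) Ab nzA => Hd.
apply/RleP; apply: le_trans Hd _; rewrite RpowE natrM !RmultE.
rewrite -[leRHS]mulrA ler_wpM2l //.
apply: (@le_trans _ _ (\sum_(i < n.+1) H ^+ n * L)); last first.
  by rewrite sumr_const card_ord -[leLHS]mulr_natl.
apply: ler_sum => i _; rewrite prodr_const cardC1 card_ord ler_wpM2l //.
  by rewrite exprn_ge0 //; exact/RleP.
have -> : rVpoly (row i A) = poly_of_zpoly n (G i).
  apply/polyP => j; rewrite [RHS]coef_poly; case: ltnP => lt_jn; last first.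
    by rewrite nth_default // (leq_trans (size_poly _ _)).
  by apply: etrans (coef_rVpoly_ord (row i A) (Ordinal lt_jn)) _; rewrite !mxE.
by rewrite -peval_ev -RabsE; apply/RleP/GL/ssrnat.leP; rewrite -ltnS.
Qed.

End IntegerPolynomials.

From Stdlib Require Import List Classical IndefiniteDescription FinFun.

(** * The sequence of best approximations *)

Lemma zinterval_list (T : Z) : exists l : list Z, forall a, (Z.abs a <= T)%Z -> In a l.
Proof.
exists (map (fun k => (Z.of_nat k - T)%Z) (seq 0 (S (Z.to_nat (2 * T))))).
intros a Ha; apply in_map_iff; exists (Z.to_nat (a + T)); split; [lia|].
apply in_seq; lia.
Qed.

(** Listing values instead of polynomials avoids comparing coefficient functions, which are
    unconstrained beyond index [n]. *)
Lemma bounded_height_values (n : nat) (T : Z) (zeta : R) :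
  exists l : list R, forall P, (height n P <= T)%Z -> In (peval n P zeta) l.
Proof.
induction n as [|n [l Hl]].
- destruct (zinterval_list T) as [m Hm].
  exists (map (fun a => IZR a * zeta ^ 0) m); intros P HP.
  apply in_map_iff; exists (P 0%nat); split; [reflexivity|]; apply Hm; exact HP.
- destruct (zinterval_list T) as [m Hm].
  exists (map (fun q => fst q + IZR (snd q) * zeta ^ S n) (list_prod l m)).
  intros P HP; simpl in HP; apply in_map_iff.
  exists (peval n P zeta, P (S n)); split; [reflexivity|].
  apply in_prod; [apply Hl | apply Hm]; lia.
Qed.

Lemma list_pos_lower_bound (l : list R) :
  exists c, 0 < c /\ forall x, In x l -> 0 < x -> c <= x.
Proof.
induction l as [|a l [c [Hc Hl]]].
- exists 1; split; [lra|]; intros x [].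
- destruct (Rlt_le_dec 0 a) as [Ha|Ha].
  + exists (Rmin a c); split; [apply Rmin_pos; assumption|].
    intros x [<-|Hx] H0; [apply Rmin_l|].
    apply Rle_trans with c; [apply Rmin_r | apply Hl; assumption].
  + exists c; split; [exact Hc|]; intros x [<-|Hx] H0; [lra | apply Hl; assumption].
Qed.

Lemma list_upper_bound (l : list R) : exists M, forall x, In x l -> x < M.
Proof.
induction l as [|a l [M HM]].
- exists 0; intros x [].
- exists (Rmax (a + 1) M); intros x [<-|Hx].
  + apply Rlt_le_trans with (a + 1); [lra | apply Rmax_l].
  + apply Rlt_le_trans with M; [apply HM, Hx | apply Rmax_r].
Qed.

Lemma list_max_such_that (l : list R) (V : R -> Prop) :
  (exists x, In x l /\ V x) ->
  exists m, V m /\ forall x, In x l -> V x -> x <= m.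
Proof.
induction l as [|a l IH]; intros [x [Hx Vx]]; [destruct Hx|].
destruct (classic (exists y, In y l /\ V y)) as [H|H].
- destruct (IH H) as [m [Vm Hm]]; destruct (classic (V a)) as [Va|Va].
  + destruct (Rle_lt_dec a m).
    * exists m; split; [exact Vm|]; intros y [<-|Hy] Vy; auto.
    * exists a; split; [exact Va|]; intros y [<-|Hy] Vy; [lra|].
      specialize (Hm y Hy Vy); lra.
  + exists m; split; [exact Vm|]; intros y [<-|Hy] Vy; [contradiction | auto].
- destruct Hx as [->|Hx]; [|destruct H; eauto].
  exists x; split; [exact Vx|]; intros y [<-|Hy] Vy; [lra|]; destruct H; eauto.
Qed.

Lemma decreasing_leaves_list (u : nat -> R) (l : list R) :
  (forall k, u (S k) < u k) -> exists k, ~ In (u k) l.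
Proof.
intros Hu; apply NNPP; intros Hn.
assert (Hin : forall k, In (u k) l) by (intro k; apply NNPP; intro; apply Hn; eauto).
assert (Hlt : forall j k, (j < k)%nat -> u k < u j).
{ intros j k Hjk; induction Hjk as [|k Hjk IH]; [apply Hu|].
  specialize (Hu k); lra. }
assert (Hnd : NoDup (map u (seq 0 (S (length l))))).
{ apply FinFun.Injective_map_NoDup; [|apply seq_NoDup].
  intros j k E; destruct (Nat.lt_total j k) as [H|[H|H]]; [|exact H|];
    specialize (Hlt _ _ H); lra. }
assert (Hincl : incl (map u (seq 0 (S (length l)))) l).
{ intros x Hx; apply in_map_iff in Hx; destruct Hx as [k [<- _]]; apply Hin. }
pose proof (NoDup_incl_length Hnd Hincl) as H.
rewrite length_map, length_seq in H; lia.
Qed.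

Lemma peval_add (n : nat) (P Q : zpoly) (x : R) :
  peval n (fun i => (P i + Q i)%Z) x = peval n P x + peval n Q x.
Proof.
unfold peval; rewrite <- sum_plus; apply sum_eq; intros i _.
rewrite plus_IZR; ring.
Qed.

Lemma peval_opp (n : nat) (P : zpoly) (x : R) :
  peval n (fun i => (- P i)%Z) x = - peval n P x.
Proof.
unfold peval; induction n as [|n IH]; simpl sum_f_R0; rewrite ?IH, opp_IZR; ring.
Qed.

Lemma height_ext (n : nat) (P Q : zpoly) :
  (forall i, Z.abs (P i) = Z.abs (Q i)) -> height n P = height n Q.
Proof. intros H; induction n as [|n IH]; simpl; [|rewrite IH]; rewrite H; reflexivity. Qed.

Section BestApproximations.
Variables (n : nat) (zeta : R).
Hypothesis zeta_transcendental : transcendental zeta.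
Local Notation value P := (Rabs (peval n P zeta)).

Lemma value_pos (P : zpoly) : deg_le P n -> nonzero_le n P -> 0 < value P.
Proof. intros dP nP; apply Rabs_pos_lt, zeta_transcendental; assumption. Qed.

Lemma peval_eq0 (P : zpoly) : deg_le P n -> peval n P zeta = 0 -> forall i, P i = 0%Z.
Proof.
intros dP P0 i; destruct (Nat.le_gt_cases i n) as [Hi|Hi]; [|apply dP, Hi].
apply NNPP; intros Pi; apply (zeta_transcendental n P dP); [exists i; auto | exact P0].
Qed.

Lemma value_inj (P Q : zpoly) : deg_le P n -> deg_le Q n -> value P = value Q ->
  (forall i, P i = Q i) \/ (forall i, P i = (- Q i)%Z).
Proof.
intros dP dQ E.
assert (E0 : peval n P zeta = peval n Q zeta \/ peval n P zeta = - peval n Q zeta).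
{ revert E; unfold Rabs; destruct (Rcase_abs _), (Rcase_abs _); intros; lra. }
destruct E0 as [E1|E1].
- left; intros i.
  assert (H : (P i + - Q i)%Z = 0%Z).
  { apply (peval_eq0 (fun i => (P i + - Q i)%Z)).
    - intros j Hj; rewrite (dP j Hj), (dQ j Hj); reflexivity.
    - rewrite peval_add, peval_opp; lra. }
  lia.
- right; intros i.
  assert (H : (P i + Q i)%Z = 0%Z).
  { apply (peval_eq0 (fun i => (P i + Q i)%Z)).
    - intros j Hj; rewrite (dP j Hj), (dQ j Hj); reflexivity.
    - rewrite peval_add; lra. }
  lia.
Qed.

Lemma value_inj_height (P Q : zpoly) : deg_le P n -> deg_le Q n ->
  value P = value Q -> height n P = height n Q.
Proof.
intros dP dQ E; apply height_ext.
destruct (value_inj P Q dP dQ E) as [H|H]; intros i; rewrite H; lia.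
Qed.

Lemma bounded_height_abs_values (T : Z) :
  exists l : list R, forall P, (height n P <= T)%Z -> In (value P) l.
Proof.
destruct (bounded_height_values n T zeta) as [l Hl]; exists (map Rabs l).
intros P HP; apply in_map, Hl, HP.
Qed.

(** Take the least value among polynomials of height at most that of [Q]. Strictness holds because
    equal values force equality up to sign, hence equal heights. *)
Lemma best_approx_below (Q : zpoly) : deg_le Q n -> nonzero_le n Q ->
  exists P, best_approx n zeta P /\ (height n P <= height n Q)%Z /\ value P <= value Q.
Proof.
intros dQ nQ; destruct (bounded_height_abs_values (height n Q)) as [l Hl].
destruct (list_max_such_that (map Ropp l) (fun x => exists P, deg_le P n /\
  nonzero_le n P /\ (height n P <= height n Q)%Z /\ x = - value P)) as [m [Vm Hm]].
{ exists (- value Q); split; [apply in_map, Hl; lia|].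
  exists Q; repeat split; auto; lia. }
destruct Vm as [P [dP [nP [hP Em]]]].
assert (Hmin : forall S, deg_le S n -> nonzero_le n S -> (height n S <= height n Q)%Z ->
  value P <= value S).
{ intros S dS nS hS.
  assert (- value S <= m); [|lra].
  apply Hm; [apply in_map, Hl, hS | exists S; auto]. }
exists P; split; [|split; [exact hP | apply Hmin; auto; lia]].
split; [exact dP|split; [exact nP|]]; intros S dS nS hS.
destruct (Rle_lt_or_eq_dec (value P) (value S)) as [H|H]; [apply Hmin; auto; lia|exact H|].
pose proof (value_inj_height P S dP dS H); lia.
Qed.

(** This keeps the sequence of best approximations from terminating; a positive admissible exponent
    provides it. *)
Hypothesis small_polynomials : forall v, 0 < v ->
  exists Q, deg_le Q n /\ nonzero_le n Q /\ value Q < v.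

(** A polynomial with value below [v] bounds the height of every best approximation with value at
    least [v]. *)
Lemma best_approx_values_finite (v : R) : 0 < v ->
  exists l, forall P, best_approx n zeta P -> v <= value P -> In (value P) l.
Proof.
intros Hv; destruct (small_polynomials v Hv) as [Q [dQ [nQ Qv]]].
destruct (bounded_height_abs_values (height n Q)) as [l Hl].
exists l; intros P [dP [nP bP]] HP; apply Hl.
destruct (Z.le_gt_cases (height n P) (height n Q)) as [H|H]; [exact H|].
specialize (bP Q dQ nQ H); lra.
Qed.

Lemma next_best_approx (v : R) : 0 < v -> exists P, best_approx n zeta P /\
  value P < v /\ forall Q, best_approx n zeta Q -> value Q < v -> value Q <= value P.
Proof.
intros Hv; destruct (small_polynomials v Hv) as [Q [dQ [nQ Qv]]].
destruct (best_approx_below Q dQ nQ) as [P0 [bP0 [_ PQ]]].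
assert (P0pos : 0 < value P0) by (apply value_pos; apply bP0).
destruct (best_approx_values_finite (value P0) P0pos) as [l Hl].
destruct (list_max_such_that l (fun x => x < v /\ exists P, best_approx n zeta P /\
  x = value P)) as [m [[mv [P [bP ->]]] Hm]].
{ exists (value P0); split; [apply Hl; auto; lra|]; split; [lra|]; eauto. }
exists P; split; [exact bP|split; [exact mv|]]; intros S bS Sv.
destruct (Rle_lt_dec (value P0) (value S)) as [H|H]; [apply Hm; eauto|].
assert (value P0 <= value P); [|lra].
apply Hm; [apply Hl; auto; lra|]; split; [lra|eauto].
Qed.

(** Repeatedly take the largest value still available. A best approximation missed in this way would
    lie below infinitely many values of best approximations, against their finiteness above any
    positive bound. *)
Lemma best_approx_seq_exists : exists Pseq, best_approx_seq n zeta Pseq.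
Proof.
(* Choice needs a total relation, so the zero polynomial is the dummy answer for [v <= 0]. *)
destruct (functional_choice (fun v P => 0 < v -> best_approx n zeta P /\
  value P < v /\ forall Q, best_approx n zeta Q -> value Q < v -> value Q <= value P))
  as [next Hnext].
{ intros v; destruct (Rlt_le_dec 0 v) as [Hv|Hv].
  - destruct (next_best_approx v Hv) as [P HP]; exists P; auto.
  - exists (fun _ => 0%Z); intros; lra. }
destruct (best_approx_values_finite 1 Rlt_0_1) as [l Hl].
destruct (list_upper_bound l) as [M0 HM0]; set (M := Rmax 1 M0).
assert (HM : forall P, best_approx n zeta P -> value P < M).
{ intros P bP; destruct (Rlt_le_dec (value P) 1) as [H|H].
  - apply Rlt_le_trans with 1; [exact H | apply Rmax_l].
  - apply Rlt_le_trans with M0; [apply HM0, Hl; assumption | apply Rmax_r]. }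
assert (Mpos : 0 < M) by (apply Rlt_le_trans with 1; [lra | apply Rmax_l]).
set (Pseq := fix F k := match k with O => next M | S j => next (value (F j)) end).
assert (Hbest : forall k, best_approx n zeta (Pseq k)).
{ induction k as [|k IH]; [apply Hnext, Mpos|].
  apply (Hnext (value (Pseq k))), value_pos; apply IH. }
assert (Hpos : forall k, 0 < value (Pseq k)) by (intro k; apply value_pos; apply Hbest).
exists Pseq; split; [exact Hbest|split].
{ intros k; apply (Hnext (value (Pseq k))), Hpos. }
intros P bP; apply NNPP; intros Hnot.
assert (Hne : forall k, value P <> value (Pseq k)).
{ intros k E; apply Hnot; exists k; apply value_inj; [apply bP | apply Hbest | exact E]. }
assert (Hlt : forall k, value P < value (Pseq k)).
{ induction k as [|k IH].
  - destruct (Hnext M Mpos) as [_ [_ H]]; specialize (H P bP (HM P bP)).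
    specialize (Hne 0%nat); simpl in Hne |- *; lra.
  - destruct (Hnext _ (Hpos k)) as [_ [_ H]]; specialize (H P bP IH).
    specialize (Hne (S k)); simpl in Hne |- *; lra. }
destruct (best_approx_values_finite (value P)) as [m Hm]; [apply value_pos; apply bP|].
destruct (decreasing_leaves_list (fun k => value (Pseq k)) m) as [k Hk].
{ intros k; apply (Hnext (value (Pseq k))), Hpos. }
apply Hk, Hm; [apply Hbest | left; apply Hlt].
Qed.

Lemma best_approx_seq_height_le (Pseq : nat -> zpoly) : best_approx_seq n zeta Pseq ->
  forall k, (height n (Pseq k) <= height n (Pseq (S k)))%Z.
Proof.
intros [Hb [Hd _]] k; destruct (Hb k) as [_ [_ H]]; destruct (Hb (S k)) as [d1 [n1 _]].
specialize (H _ d1 n1); specialize (Hd k).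
destruct (Z.le_gt_cases (height n (Pseq k)) (height n (Pseq (S k)))) as [L|L]; [exact L|].
specialize (H L); lra.
Qed.

Lemma best_approx_seq_height_infty (Pseq : nat -> zpoly) : best_approx_seq n zeta Pseq ->
  forall T, exists K, forall k, (K <= k)%nat -> (T < height n (Pseq k))%Z.
Proof.
intros HP T; destruct (bounded_height_abs_values T) as [l Hl].
destruct (decreasing_leaves_list (fun k => value (Pseq k)) l) as [K HK]; [apply HP|].
exists K; intros k Hk; induction Hk as [|k Hk IH].
- destruct (Z.le_gt_cases (height n (Pseq K)) T) as [H|H]; [|exact H].
  destruct HK; apply Hl, H.
- pose proof (best_approx_seq_height_le Pseq HP k); lia.
Qed.

(** Some best approximation is no larger than [Q] in height and value. It is [Pseq j] up to sign,
    and its height forces [j <= k]. *)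
Lemma best_approx_seq_value_le (Pseq : nat -> zpoly) (k : nat) (Q : zpoly) :
  best_approx_seq n zeta Pseq -> deg_le Q n -> nonzero_le n Q ->
  (height n Q < height n (Pseq (S k)))%Z -> value (Pseq k) <= value Q.
Proof.
intros HP dQ nQ hQ; destruct (best_approx_below Q dQ nQ) as [P [bP [hP PQ]]].
pose proof (best_approx_seq_height_le Pseq HP) as Hh; destruct HP as [Hb [Hd Hall]].
destruct (Hall P bP) as [j Hj].
assert (Ev : value P = value (Pseq j)).
{ destruct Hj as [Hj|Hj].
  - f_equal; unfold peval; apply sum_eq; intros i _; rewrite Hj; reflexivity.
  - rewrite <- (Rabs_Ropp (peval n (Pseq j) zeta)), <- peval_opp; f_equal.
    unfold peval; apply sum_eq; intros i _; rewrite Hj; reflexivity. }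
assert (Eh : height n P = height n (Pseq j)).
{ apply height_ext; destruct Hj as [Hj|Hj]; intros i; rewrite Hj; lia. }
assert (Hmono : forall a b, (a <= b)%nat -> (height n (Pseq a) <= height n (Pseq b))%Z /\
  value (Pseq b) <= value (Pseq a)).
{ intros a b Hab; induction Hab as [|b Hab IH]; [split; [lia | lra]|].
  specialize (Hh b); specialize (Hd b); split; [lia|lra]. }
destruct (Nat.le_gt_cases j k) as [L|L].
- destruct (Hmono j k L); lra.
- destruct (Hmono (S k) j L); lia.
Qed.

End BestApproximations.

(** * Growth of the heights *)

Lemma exp_neg_lt_inv (x : R) : 0 < x -> exp (- x) < / (1 + x).
Proof.
intros Hx; rewrite exp_Ropp; apply Rinv_lt_contravar; [|apply exp_ineq1; lra].
apply Rmult_lt_0_compat; [lra | apply exp_pos].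
Qed.

Lemma ln_2_lt_1 : ln 2 < 1.
Proof.
rewrite <- (ln_exp 1); apply ln_increasing; [lra|]; pose proof (exp_ineq1 1); lra.
Qed.

(* For large [m] the power is at most about [2 exp (- eps)], while [nu / (m + 1)] is close
   to [2]. *)
Lemma growth_ratio_bound (eps nu : R) (m : nat) :
  0 < eps <= 1 / 2 -> 1 + 2 / eps <= INR m ->
  2 * INR (S m) - 1 - ln 2 + eps < nu ->
  0 < INR m / (nu - INR (S m)) /\
  INR (S m) * (INR m / (nu - INR (S m))) ^ m < nu.
Proof.
intros Heps Hm Hnu; rewrite S_INR in *; set (N := INR m) in *.
pose proof ln_lt_2 as Hln.
pose proof ln_2_lt_1 as Hln1.
set (c := ln 2 - eps) in *.
assert (Hie : 0 < 2 / eps) by (apply Rdiv_lt_0_compat; lra).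
assert (HeN : 2 + eps <= N * eps).
{ replace (2 + eps) with ((1 + 2 / eps) * eps) by (field; lra).
  apply Rmult_le_compat_r; lra. }
assert (Hi1 : / (N - c) <= eps / 2).
{ replace (eps / 2) with (/ (2 / eps)) by (field; lra).
  apply Rinv_le_contravar; unfold c; lra. }
assert (Hc : 0 <= c < 1) by (unfold c; lra).
assert (HNc : 0 < N - c) by lra.
set (a := nu - (N + 1)) in *; assert (Ha : N - c < a) by (unfold a, c in *; lra).
assert (Hlam : 0 < N / a) by (apply Rdiv_lt_0_compat; lra).
split; [exact Hlam|].
(* From [ln x <= x - 1] and [N - c < a]. Multiplied by [N], the bound is [c + c^2 / (N - c)], whose
   second term is at most [eps / 2]; half of [eps] is thus retained. *)
assert (Hlnlam : ln (N / a) <= c / (N - c)).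
{ apply Rle_trans with (N / a - 1).
  - pose proof (exp_ineq1_le (ln (N / a))) as H; rewrite exp_ln in H; lra.
  - apply Rle_trans with (N / (N - c) - 1); [|right; field; lra].
    apply Rplus_le_compat_r; unfold Rdiv; apply Rmult_le_compat_l; [lra|].
    apply Rinv_le_contravar; lra. }
assert (HNln : N * ln (N / a) <= ln 2 - eps / 2).
{ apply Rle_trans with (N * (c / (N - c))); [apply Rmult_le_compat_l; lra|].
  replace (N * (c / (N - c))) with (c + c * c * / (N - c)) by (field; lra).
  assert (c * c * / (N - c) <= 1 * (eps / 2)); [|unfold c in *; lra].
  apply Rmult_le_compat; [nra | left; apply Rinv_0_lt_compat; lra | nra | lra]. }
assert (Hpow : (N / a) ^ m < 2 * / (1 + eps / 2)).
{ rewrite <- Rpower_pow by exact Hlam; fold N; unfold Rpower.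
  apply Rle_lt_trans with (exp (ln 2 + - (eps / 2))).
  - destruct (Rle_lt_or_eq_dec _ _ HNln) as [H|H].
    + left; apply exp_increasing; fold N; lra.
    + right; f_equal; fold N; lra.
  - rewrite exp_plus, exp_ln by lra; apply Rmult_lt_compat_l; [lra|].
    apply exp_neg_lt_inv; lra. }
apply Rlt_trans with ((N + 1) * (2 * / (1 + eps / 2))).
- apply Rmult_lt_compat_l; lra.
- apply Rle_lt_trans with (2 * N).
  + apply (Rmult_le_reg_r (1 + eps / 2)); [lra|].
    replace ((N + 1) * (2 * / (1 + eps / 2)) * (1 + eps / 2)) with (2 * (N + 1))
      by (field; lra).
    lra.
  + unfold a, c in *; lra.
Qed.

Lemma affine_recursion_bound (h : nat -> R) (lam D : R) (K : nat) :
  0 < lam -> (forall k, (K <= k)%nat -> h (S k) <= lam * h k + D) ->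
  forall i, exists E, forall k, (K <= k)%nat -> h (k + i)%nat <= lam ^ i * h k + E.
Proof.
intros Hlam Hh i; induction i as [|i [E HE]].
- exists 0; intros k Hk; rewrite Nat.add_0_r; simpl; lra.
- exists (lam * E + D); intros k Hk; rewrite Nat.add_succ_r.
  apply Rle_trans with (lam * h (k + i)%nat + D); [apply Hh; lia|].
  replace (lam ^ S i * h k + (lam * E + D)) with (lam * (lam ^ i * h k + E) + D)
    by (simpl; ring).
  apply Rplus_le_compat_r, Rmult_le_compat_l; [lra|]; apply HE, Hk.
Qed.

(** Iterating the recursion [m] times from [S k] turns the last hypothesis into an upper bound for
    [(nu - b * lam ^ m) * h (S k)] at arbitrarily large [k], although [h] tends to infinity. *)
Lemma affine_recursion_contradiction (h : nat -> R) (nu b D E lam : R) (m K : nat) :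
  0 < lam -> 0 <= b -> b * lam ^ m < nu ->
  (forall k, (K <= k)%nat -> h (S k) <= lam * h k + D) ->
  (forall T, exists J, forall k, (J <= k)%nat -> T < h k) ->
  (forall J, exists k, (J <= k)%nat /\ nu * h (S k) <= b * h (S k + m)%nat + E) ->
  False.
Proof.
intros Hlam Hb Hgap Hrec Hinf Hinfl.
destruct (affine_recursion_bound h lam D K Hlam Hrec m) as [E1 HE1].
destruct (Hinf ((b * E1 + E) / (nu - b * lam ^ m))) as [J HJ].
destruct (Hinfl (K + J)%nat) as [k [Hk H]].
specialize (HE1 (S k) ltac:(lia)); specialize (HJ (S k) ltac:(lia)).
apply (Rmult_lt_compat_r (nu - b * lam ^ m)) in HJ; [|lra].
unfold Rdiv in HJ; rewrite Rmult_assoc, Rinv_l, Rmult_1_r in HJ by lra.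
apply (Rmult_le_compat_l b) in HE1; [|exact Hb]; lra.
Qed.

(** * Consequences of an admissible exponent *)

Lemma Rpower_neg_small (d v : R) : 0 < d -> 0 < v ->
  exists X0, 0 < X0 /\ forall X, X0 <= X -> Rpower X (- d) < v.
Proof.
intros Hd Hv; exists (exp ((- ln v + 1) / d)); split; [apply exp_pos|].
intros X HX; unfold Rpower; rewrite <- (exp_ln v) by exact Hv.
apply exp_increasing.
assert (H : (- ln v + 1) / d <= ln X).
{ rewrite <- (ln_exp ((- ln v + 1) / d)); destruct HX as [HX| <-]; [|lra].
  left; apply ln_increasing; [apply exp_pos | exact HX]. }
apply (Rmult_le_compat_r d) in H; [|lra].
unfold Rdiv in H; rewrite Rmult_assoc, Rinv_l, Rmult_1_r in H by lra; lra.
Qed.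

Lemma admissible_small_polynomials (n : nat) (zeta nu : R) :
  0 < nu -> what_admissible n zeta nu -> forall v, 0 < v ->
  exists Q, deg_le Q n /\ nonzero_le n Q /\ Rabs (peval n Q zeta) < v.
Proof.
intros Hnu [X0 HX] v Hv; destruct (Rpower_neg_small nu v Hnu Hv) as [X1 [_ H1]].
destruct (HX (Rmax X0 X1) (Rmax_l _ _)) as [P [dP [nP [_ HP]]]].
exists P; repeat split; auto.
apply Rle_lt_trans with (1 := HP), H1, Rmax_r.
Qed.

Lemma pow_Rpower_neg (X nu : R) (e : nat) : 0 < X ->
  X ^ e * Rpower X (- nu) = Rpower X (- (nu - INR e)).
Proof.
intros HX; rewrite <- Rpower_pow, <- Rpower_plus by exact HX; f_equal; ring.
Qed.

Lemma admissible_has_small_values (n : nat) (zeta nu : R) : (1 <= n)%nat ->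
  2 * INR n - 2 < nu -> what_admissible n zeta nu -> has_small_values n zeta.
Proof.
intros Hn Hnu [X0 HX] C.
assert (He : INR (2 * (n - 1)) = 2 * INR n - 2).
{ rewrite mult_INR, minus_INR by exact Hn; simpl; lra. }
destruct (Rpower_neg_small (nu - INR (2 * (n - 1))) (/ (Rabs C + 1))) as [X1 [X1pos H1]].
{ lra. }
{ apply Rinv_0_lt_compat; pose proof (Rabs_pos C); lra. }
destruct (INR_unbounded (Rmax X0 X1)) as [T HT].
exists T; intros X TX; apply le_INR in TX.
assert (HX0 : X0 <= INR X) by (pose proof (Rmax_l X0 X1); lra).
assert (HX1 : X1 <= INR X) by (pose proof (Rmax_r X0 X1); lra).
destruct (HX (INR X) HX0) as [P [dP [nP [hP vP]]]].
exists P; split; [exact nP|split; [exact hP|]].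
specialize (H1 (INR X) HX1); rewrite <- pow_Rpower_neg in H1 by lra.
assert (Hpow : 0 < INR X ^ (2 * (n - 1))) by (apply pow_lt; lra).
assert (Hval : INR X ^ (2 * (n - 1)) * Rabs (peval n P zeta) <= / (Rabs C + 1)).
{ left; apply Rle_lt_trans with (2 := H1), Rmult_le_compat_l; lra. }
pose proof (Rabs_pos C) as HC; rewrite Rmult_assoc.
apply Rle_trans with ((Rabs C + 1) * / (Rabs C + 1)); [|right; field; lra].
assert (Hnn : 0 <= INR X ^ (2 * (n - 1)) * Rabs (peval n P zeta)).
{ apply Rmult_le_pos; [lra | apply Rabs_pos]. }
apply Rle_trans with ((Rabs C + 1) * (INR X ^ (2 * (n - 1)) * Rabs (peval n P zeta))).
- apply Rmult_le_compat_r; [exact Hnn|]; pose proof (Rle_abs C); lra.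
- apply Rmult_le_compat_l; lra.
Qed.

Lemma transcendental_values_bounded_below (zeta : R) :
  transcendental zeta -> values_bounded_below zeta.
Proof.
intros Ht n T; destruct (bounded_height_abs_values n zeta T) as [l Hl].
destruct (list_pos_lower_bound l) as [c [Hc H]].
exists c; split; [exact Hc|]; intros P dP nP hP.
apply H; [apply Hl, hP | apply value_pos; assumption].
Qed.

(** Admissibility is used at half the height of [Pseq (S k)]: the polynomial it gives has strictly
    smaller height, so its value is at least that of [Pseq k]. *)
Lemma best_approx_seq_admissible (n : nat) (zeta nu : R) (Pseq : nat -> zpoly) :
  transcendental zeta -> best_approx_seq n zeta Pseq -> 0 < nu ->
  what_admissible n zeta nu -> exists K, forall k, (K <= k)%nat ->
  Rabs (peval n (Pseq k) zeta) <= Rpower (IZR (height n (Pseq (S k))) / 2) (- nu).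
Proof.
intros Ht HP Hnu [X0 HX].
destruct (best_approx_seq_height_infty n zeta Pseq HP (up (2 * Rabs X0))) as [K HK].
exists K; intros k Hk; specialize (HK (S k) ltac:(lia)); apply IZR_lt in HK.
pose proof (archimed (2 * Rabs X0)) as [Hup _].
pose proof (Rle_abs X0); pose proof (Rabs_pos X0).
destruct (HX (IZR (height n (Pseq (S k))) / 2)) as [Q [dQ [nQ [hQ vQ]]]]; [lra|].
apply Rle_trans with (2 := vQ), best_approx_seq_value_le; auto.
apply lt_IZR; lra.
Qed.

Lemma ln_pow_nat (x : R) (e : nat) : 0 < x -> ln (x ^ e) = INR e * ln x.
Proof.
intros Hx; rewrite <- Rpower_pow by exact Hx; unfold Rpower; apply ln_exp.
Qed.

Lemma ln_Rle (x y : R) : 0 < x -> x <= y -> ln x <= ln y.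
Proof. intros Hx [H| ->]; [left; apply ln_increasing; assumption | lra]. Qed.

Lemma height_ge1 (n : nat) (P : zpoly) : nonzero_le n P -> 1 <= IZR (height n P).
Proof.
intros [i [Hi nz]]; apply IZR_le; pose proof (coef_le_height n P i Hi); lia.
Qed.

(** * Inequalities between logarithms of heights *)

Section LogHeights.
Variables (m : nat) (zeta nu : R) (Pseq : nat -> zpoly).
Local Notation n := (S m).
Local Notation H k := (IZR (height n (Pseq k))).
Local Notation L k := (Rabs (peval n (Pseq k) zeta)).
Local Notation h k := (ln (H k)).
Hypothesis Ht : transcendental zeta.
Hypothesis HP : best_approx_seq n zeta Pseq.
Hypothesis Hnu : 2 * INR n - 2 < nu.
Hypothesis Hadm : what_admissible n zeta nu.

Lemma nu_pos : 0 < nu.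
Proof. rewrite S_INR in Hnu; pose proof (pos_INR m); lra. Qed.

Lemma seq_height_ge1 (k : nat) : 1 <= H k.
Proof. apply height_ge1, HP. Qed.

Lemma seq_value_pos (k : nat) : 0 < L k.
Proof. apply value_pos; [exact Ht | apply HP | apply HP]. Qed.

Lemma log_height_infty (T : R) : exists J, forall k, (J <= k)%nat -> T < h k.
Proof.
destruct (best_approx_seq_height_infty n zeta Pseq HP (up (exp T))) as [K HK].
exists K; intros k Hk; specialize (HK k Hk); apply IZR_lt in HK.
pose proof (archimed (exp T)) as [Hup _].
rewrite <- (ln_exp T); apply ln_increasing; [apply exp_pos | lra].
Qed.

Lemma log_value_le : exists K, forall k, (K <= k)%nat ->
  ln (L k) <= - nu * (h (S k) - ln 2).
Proof.
destruct (best_approx_seq_admissible n zeta nu Pseq Ht HP nu_pos Hadm) as [K HK].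
exists K; intros k Hk; pose proof (seq_height_ge1 (S k)) as H1.
replace (h (S k) - ln 2) with (ln (H (S k) / 2))
  by (unfold Rdiv; rewrite ln_mult, ln_Rinv by lra; ring).
rewrite <- (ln_exp (- nu * _)).
apply ln_Rle; [apply seq_value_pos | apply HK, Hk].
Qed.

Lemma log_height_recursion : exists D K, forall k, (K <= k)%nat ->
  (nu - INR n) * h (S k) <= INR m * h k + D.
Proof.
destruct (@IntegerPolynomials.consecutive_height_bound_zpoly n zeta ltac:(lia)
  (transcendental_values_bounded_below zeta Ht)
  (admissible_has_small_values n zeta nu ltac:(lia) Hnu Hadm)) as [C [HC Hcons]].
destruct log_value_le as [K1 HK1].
assert (He : INR (2 * (n - 1)) < nu).
{ rewrite mult_INR, minus_INR by lia; change (INR 2) with 2; change (INR 1) with 1; lra. }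
set (e := (2 * (n - 1))%nat) in *.
(* Beyond this threshold [ln C + INR e * h (S k) + ln (L k)] is negative, by [log_value_le]; this is
   the smallness condition of the resultant bound. *)
destruct (log_height_infty ((ln C + nu * ln 2) / (nu - INR e))) as [K2 HK2].
exists (ln C + nu * ln 2), (K1 + K2)%nat; intros k Hk.
pose proof (seq_height_ge1 k) as H0; pose proof (seq_height_ge1 (S k)) as H1.
pose proof (seq_value_pos k) as HL.
specialize (HK1 k ltac:(lia)); specialize (HK2 (S k) ltac:(lia)).
assert (Hsmall : C * (H (S k) ^ e * L k) < 1).
{ assert (Hp : 0 < H (S k) ^ e) by (apply pow_lt; lra).
  apply ln_lt_inv; [repeat apply Rmult_lt_0_compat; assumption | lra|].
  rewrite 2!ln_mult, ln_pow_nat, ln_1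
  by (first [assumption | lra | apply Rmult_lt_0_compat; assumption]).
  apply (Rmult_lt_compat_r (nu - INR e)) in HK2; [|lra].
  unfold Rdiv in HK2; rewrite Rmult_assoc, Rinv_l, Rmult_1_r in HK2 by lra; lra. }
pose proof (Hcons (Pseq k) (Pseq (S k)) (proj1 (proj2 (proj1 HP k)))
  (proj1 (proj2 (proj1 HP (S k)))) (best_approx_seq_height_le n zeta Pseq HP k)
  (proj1 (proj2 HP) k) Hsmall) as Hres.
replace (n - 1)%nat with m in Hres by lia.
assert (Hp0 : 0 < H k ^ m) by (apply pow_lt; lra).
assert (Hp1 : 0 < H (S k) ^ n) by (apply pow_lt; lra).
assert (Hpp : 0 < H k ^ m * H (S k) ^ n) by (apply Rmult_lt_0_compat; assumption).
apply ln_Rle in Hres; [|lra].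
rewrite 3!ln_mult, !ln_pow_nat, ln_1 in Hres
  by (first [assumption | lra | apply Rmult_lt_0_compat; assumption]).
lra.
Qed.

(** Along [Pseq k, ..., Pseq (k + n)] the last height and the first value are the largest. The last
    index is written [S k + m] because [m] steps of the recursion lead to it from [S k]. *)
Lemma log_height_indep : exists E, forall k, lin_indep n (fun j => Pseq (k + j)%nat) ->
  0 <= E + (INR n * h (S k + m)%nat + ln (L k)).
Proof.
destruct (@IntegerPolynomials.lin_indep_height_bound n zeta) as [C [HC Hdet]].
exists (ln C); intros k Hind; pose proof (best_approx_seq_height_le n zeta Pseq HP) as Hh.
assert (Hmono : forall i, (i <= n)%nat ->
  IZR (height n (Pseq (k + i)%nat)) <= H (S k + m)%nat).
{ intros i Hi; apply IZR_le; replace (S k + m)%nat with ((k + i) + (n - i))%nat by lia.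
  generalize (n - i)%nat; intros j; induction j as [|j IH].
  - rewrite Nat.add_0_r; lia.
  - rewrite Nat.add_succ_r; specialize (Hh (k + i + j)%nat); lia. }
assert (Hval : forall i, (i <= n)%nat -> Rabs (peval n (Pseq (k + i)%nat) zeta) <= L k).
{ intros i _; induction i as [|i IH]; [rewrite Nat.add_0_r; lra|].
  rewrite Nat.add_succ_r; pose proof (proj1 (proj2 HP) (k + i)%nat); lra. }
pose proof (seq_height_ge1 (S k + m)) as H1; pose proof (seq_value_pos k) as HL.
assert (H0 : 0 <= H (S k + m)%nat) by lra.
specialize (Hdet _ _ _ Hind H0 Hmono Hval).
assert (Hp : 0 < H (S k + m)%nat ^ n) by (apply pow_lt; lra).
apply ln_Rle in Hdet; [|lra].
rewrite 2!ln_mult, ln_pow_nat, ln_1 in Hdet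
  by (first [assumption | lra | apply Rmult_lt_0_compat; assumption]).
exact Hdet.
Qed.

End LogHeights.

Theorem theorem4p2 :
  (forall (n : nat) (zeta : R), (1 <= n)%nat -> transcendental zeta ->
     forall Pseq : nat -> zpoly, best_approx_seq n zeta Pseq ->
     forall K : nat, exists k : nat, (K <= k)%nat /\
       lin_indep n (fun j => Pseq (k + j)%nat)) ->
  forall eps : R, 0 < eps ->
  exists n0 : nat, forall (zeta : R) (n : nat),
    transcendental zeta -> (n0 <= n)%nat ->
    forall nu : R, what_admissible n zeta nu ->
      nu <= 2 * INR n - 1 - ln 2 + eps.
Proof.
(* With [eps] at most one half, [ln 2 - eps] stays nonnegative, as the growth estimate requires. *)
intros Hindep eps0 Heps0; set (eps := Rmin eps0 (1 / 2)).
assert (Heps : 0 < eps <= 1 / 2) by (split; [apply Rmin_pos; lra | apply Rmin_r]).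
assert (Hle : eps <= eps0) by apply Rmin_l.
destruct (INR_unbounded (1 + 2 / eps)) as [m0 Hm0].
exists (S m0); intros zeta n Ht Hn nu Hadm.
destruct (Rle_lt_dec nu (2 * INR n - 1 - ln 2 + eps)) as [Hnu|Hnu]; [lra|exfalso].
destruct n as [|m]; [lia|].
assert (Hm : 1 + 2 / eps <= INR m) by (apply Rlt_le, Rlt_le_trans with (1 := Hm0), le_INR; lia).
destruct (growth_ratio_bound eps nu m Heps Hm Hnu) as [Hlam Hgap].
assert (Hln : ln 2 < 1) by exact ln_2_lt_1.
assert (Hnu2 : 2 * INR (S m) - 2 < nu) by lra.
assert (Hnupos : 0 < nu) by (apply (nu_pos m); assumption).
assert (Ha : 0 < nu - INR (S m)).
{ assert (0 < 2 / eps) by (apply Rdiv_lt_0_compat; lra). rewrite S_INR in *; lra. }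
destruct (best_approx_seq_exists (S m) zeta Ht
  (admissible_small_polynomials (S m) zeta nu Hnupos Hadm)) as [Pseq HP].
destruct (log_height_recursion m zeta nu Pseq Ht HP Hnu2 Hadm) as [D [K HK]].
destruct (log_value_le m zeta nu Pseq Ht HP Hnu2 Hadm) as [K1 HK1].
destruct (log_height_indep m zeta Pseq Ht HP) as [E HE].
(* The recursion divided by [nu - n] gives the ratio. At the infinitely many independent blocks, the
   determinant inequality and [log_value_le] give the opposing bound, with [nu * ln 2] coming from
   the halved height. *)
apply (affine_recursion_contradiction (fun k => ln (IZR (height (S m) (Pseq k)))) nu
  (INR (S m)) (D / (nu - INR (S m))) (E + nu * ln 2) (INR m / (nu - INR (S m))) m K).
- exact Hlam.
- apply pos_INR.
- exact Hgap.
- intros k Hk; specialize (HK k Hk); apply (Rmult_le_reg_l (nu - INR (S m))); [exact Ha|].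
  apply Rle_trans with (1 := HK); right; field; lra.
- apply (log_height_infty m zeta Pseq HP).
- intros J; destruct (Hindep (S m) zeta ltac:(lia) Ht Pseq HP (J + K1)%nat) as [k [Hk Hk']].
  exists k; split; [lia|]; specialize (HE k Hk'); specialize (HK1 k ltac:(lia)); lra.
Qed.
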